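(* Let $e>1$ and $1\leq p<e$ be integers, and let $s=(s_0,s_1,\dots,s_e)$ be the vector with $s_e=1$, $s_p\geq 1$, and $s_i=0$ for all $i\notin\{p,e\}$. Assume that $3\geq\text{min.emb.dim.}(s)$. Then there exists a generalized compressed algebra for the pair $(3,s)$ if and only if one of the following holds: i) $p<\lfloor\frac e2\rfloor$ and either $s_p\leq 2$ or $s_p\geq N(3,p)-p$; ii) $p\geq\lfloor\frac e2\rfloor$. Equivalently, there does not exist a generalized compressed algebra for the pair $(3,s)$ if and only if $$p<\lfloor\tfrac e2\rfloor\quad\text{and}\quad 3\leq s_p<N(3,p)-p.$$
   Context: Fix a field $k$ of characteristic zero. An algebra means a standard graded artinian algebra $A=R/I=\bigoplus_{i=0}^e A_i$, where $R=k[x_1,\dots,x_r]$ with all $x_i$ of degree $1$, $I$ is a homogeneous ideal containing no non-zero forms of degree $1$, and $e$ is the last index with $A_e\neq 0$. The embedding dimension of $A$ is $r$. The $h$-vector of $A$ is $h(A)=(1,h_1,\dots,h_e)$ with $h_i=\dim_k A_i$ (so $h_1=r$). The socle of $A$ is $soc(A)=\{a\in A \mid a\,\overline{m}=0\}$, where $\overline{m}$ is the maximal homogeneous ideal of $A$; it is a homogeneous ideal, and the socle-vector of $A$ is $s(A)=(s_0,\dots,s_e)$ with $s_i=\dim_k soc(A)_i$ (so $s_0=0$ and $s_e=h_e>0$). For a vector $s=(0,s_1,\dots,s_e)$, an algebra has data $(r,s)$ if it has embedding dimension $r$ and socle-vector $s$; $\text{min.emb.dim.}(s)$ is the least integer $r$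 for which there exists an algebra with data $(r,s)$. An $h$-vector $h$ is admissible for $(r,s)$ if it is the $h$-vector of some algebra with data $(r,s)$. $h$-vectors of the same length are partially ordered entrywise: $h\geq h'$ if every entry of $h$ is $\geq$ the corresponding entry of $h'$. If there is an admissible $h$-vector $h$ for $(r,s)$ with $h\geq h'$ for every other admissible $h'$ (i.e. a maximum), then any algebra with data $(r,s)$ and $h$-vector $h$ is called a generalized compressed algebra for $(r,s)$; if no such maximum exists, there is no generalized compressed algebra for $(r,s)$. Notation: $N(r,d)=\dim_k k[x_1,\dots,x_r]_d=\binom{r-1+d}{d}$; in particular $N(3,p)=\binom{p+2}{2}$. *)

(* Defs.v *)
From HB Require Import structures.
From mathcomp Require Import all_boot all_order all_algebra.
From mathcomp Require Import classical_sets.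
From mathcomp Require Import mpoly.

Set Implicit Arguments.
Unset Strict Implicit.
Unset Printing Implicit Defensive.

Import GRing.Theory.

Local Open Scope ring_scope.
Local Open Scope quotient_scope.
Local Open Scope classical_set_scope.

(* dim_k U = n, for a linear subspace U of V: U has a basis of n vectors. *)
Definition has_dim (k : fieldType) (V : lmodType k) (U : set V) (n : nat) :=
  exists b : 'I_n -> V,
    [/\ forall i, U (b i),
        forall c : 'I_n -> k, \sum_i c i *: b i = 0 -> forall i, c i = 0
      & forall u, U u -> exists c : 'I_n -> k, u = \sum_i c i *: b i].

Section QuotientAlgebra.
Variables (k : fieldType) (r : nat) (I : idealr {mpoly k[r]}).

(* The library only provides the ring structure of R/I; the alias carries in
   addition the k-module structure. *)
Definition quot_alg : Type := {ideal_quot I}.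

HB.instance Definition _ := GRing.ComNzRing.on quot_alg.

Definition quot_pi (f : {mpoly k[r]}) : quot_alg := \pi_({ideal_quot I}) f.

Lemma quot_piD : {morph quot_pi : f g / f + g}.
Proof. by move=> f g; rewrite /quot_pi rmorphD. Qed.

Lemma quot_piM : {morph quot_pi : f g / f * g}.
Proof. by move=> f g; rewrite /quot_pi rmorphM. Qed.

Lemma quot_pi1 : quot_pi 1 = 1.
Proof. by rewrite /quot_pi rmorph1. Qed.

Lemma quot_pi_eq0 f : (quot_pi f == 0) = (f \in I).
Proof. by rewrite -[f in RHS]subr0 Quotient.idealrBE rmorph0. Qed.

Definition quot_scale (c : k) (a : quot_alg) : quot_alg := quot_pi c%:MP * a.

Fact quot_scaleA c d a : quot_scale c (quot_scale d a) = quot_scale (c * d) a.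
Proof. by rewrite /quot_scale mulrA -quot_piM mpolyCM. Qed.

Fact quot_scale1 : left_id 1 quot_scale.
Proof. by move=> a; rewrite /quot_scale quot_pi1 mul1r. Qed.

Fact quot_scaleDr : right_distributive quot_scale +%R.
Proof. by move=> c a b; rewrite /quot_scale mulrDr. Qed.

Fact quot_scaleDl a : {morph quot_scale^~ a : c d / c + d}.
Proof. by move=> c d; rewrite /quot_scale mpolyCD quot_piD mulrDl. Qed.

HB.instance Definition _ := GRing.Zmodule_isLmodule.Build k quot_alg
  quot_scaleA quot_scale1 quot_scaleDr quot_scaleDl.

Definition quot_piece (d : nat) : set quot_alg :=
  [set quot_pi f | f in [set f : {mpoly k[r]} | f \is d.-homog]].

Definition quot_max_ideal : set quot_alg :=
  [set quot_pi f | f in [set f : {mpoly k[r]} | f@_0%MM = 0]].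

Definition socle : set quot_alg :=
  [set a | forall b, quot_max_ideal b -> a * b = 0].

End QuotientAlgebra.

Arguments quot_piece {k r} I d.
Arguments quot_max_ideal {k r} I.
Arguments socle {k r} I.

(* A = R/I with R = k[x_1, ..., x_r].  As the zero pieces above socdeg show, A
   is the finite sum of A_0, ..., A_socdeg, i.e. A is artinian. *)
Record graded_algebra (k : fieldType) (r : nat) := GradedAlgebra {
  alg_ideal : idealr {mpoly k[r]};
  alg_ideal_homogeneous : forall f, f \in alg_ideal ->
    forall d, pihomog mdeg d f \in alg_ideal;
  alg_ideal_no_linear : forall f, f \in alg_ideal -> f \is 1.-homog -> f = 0;
  socdeg : nat;
  socdeg_neq0 : exists2 a, quot_piece alg_ideal socdeg a & a != 0;
  socdeg_last : forall d, (socdeg < d)%N ->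
    forall a, quot_piece alg_ideal d a -> a = 0
}.

Section Data.
Variables (k : fieldType) (r : nat).
Implicit Types (A : graded_algebra k r) (h s : seq nat).

Definition h_vector A h :=
  size h = (socdeg A).+1 /\
  forall i, (i <= socdeg A)%N -> has_dim (quot_piece (alg_ideal A) i) (nth 0%N h i).

Definition socle_vector A s :=
  size s = (socdeg A).+1 /\
  forall i, (i <= socdeg A)%N ->
    has_dim (socle (alg_ideal A) `&` quot_piece (alg_ideal A) i) (nth 0%N s i).

Definition admissible s h :=
  exists A, socle_vector A s /\ h_vector A h.

(* [all2 leq h' h] also requires h' and h to have the same length. *)
Definition max_admissible s h :=
  admissible s h /\ forall h', admissible s h' -> all2 leq h' h.

Definition generalized_compressed s A :=
  exists h, [/\ max_admissible s h, socle_vector A s & h_vector A h].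

End Data.

(* The embedding dimension is the number of variables, since the ideal of a
   graded_algebra contains no nonzero linear form. *)
Definition min_emb_dim (k : fieldType) (s : seq nat) (m : nat) :=
  (exists A : graded_algebra k m, socle_vector A s) /\
  forall r, (exists A : graded_algebra k r, socle_vector A s) -> (m <= r)%N.

(* dim_k k[x_1, ..., x_r]_d, for r > 0. *)
Definition num_forms (r d : nat) : nat := 'C(r.-1 + d, d).

(* Main.v *)
(* By Macaulay duality, an algebra with this socle vector is given by a
   functional phi on the forms of degree e and s_p functionals on the forms of
   degree p; N is the Hilbert function of k[x,y,z], H that of the Gorenstein
   algebra defined by phi.  Then h_i = H_i for i > p, h_p = H_p + s_p, so that
   H_p <= c := N(p) - s_p, and only H matters outside the degrees i <= p.

   Upper bounds for H come from its concavity: if the ideal of phi contains a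
   form f <> 0 of degree t, then H_(i+1) + H_(i-1) <= 2 H_i for
   t - 1 <= i <= e - t + 1.  To see this, pick a point P with f(P) <> 0 and
   independent linear forms l, u vanishing at P.  The quotient A/lA has a
   Hilbert function d that does not increase from degree t - 1 on, because u
   maps (A/lA)_(j-1) onto (A/lA)_j for j >= t; on the other hand
   d_i = H_i - b_(i-1), where b is the (symmetric) Hilbert function of l phi.

   Functionals with large H are sums of evaluations at points (s, s^K, 1):
   adding a general point of such a curve increases by one every rank that is
   not yet maximal.  Taking K > e gives general points of the plane, and K = r
   points on a plane curve of degree r.  If p < e/2 and 3 <= s_p < N(p) - p,
   then c general points are optimal in the degrees above e - p, whereas
   points on a curve of degree max(0, p + 1 - s_p) + 1 together with a few
   general points do better in degree p + 1 than concavity allows for the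
   former, so no maximum exists. *)
Require Import Defs.
From HB Require Import structures.
From mathcomp Require Import all_boot all_order all_algebra.
From mathcomp Require Import boolp classical_sets.
From mathcomp Require Import mpoly.
From mathcomp Require Import zify ring.

Set Implicit Arguments.
Unset Strict Implicit.
Unset Printing Implicit Defensive.

Import GRing.Theory.
Local Open Scope ring_scope.

(** * Monomials and catalecticant matrices *)

Section Monomials.
Variable n : nat.

Definition monomials d : seq 'X_{1..n} :=
  [seq s2m t | t : d.-tuple 'I_n <- enum (basis n d)].

Definition nmon d := size (monomials d).

(** Indices below [nmon d] stand for the monomials of degree d, so that forms become row vectors and
    linear conditions on them become matrices. *)
Definition mon d (a : 'I_(nmon d)) : 'X_{1..n} := nth 0%MM (monomials d) a.
Arguments mon d : clear implicits.

Lemma mdeg_mon d a : mdeg (mon d a) = d.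
Proof. by apply/eqP; rewrite basis_cover mem_nth. Qed.

Lemma mon_inj d : injective (mon d).
Proof.
move=> a b /eqP; rewrite nth_uniq ?uniq_basis // => /eqP; exact: val_inj.
Qed.

Lemma monP d m : mdeg m = d -> exists a, mon d a = m.
Proof.
move=> /eqP; rewrite basis_cover => m_in.
have lt_m : (index m (monomials d) < nmon d)%N by rewrite index_mem.
by exists (Ordinal lt_m); rewrite /mon /= nth_index.
Qed.

Lemma sum_mon (V : nmodType) d (F : 'X_{1..n} -> V) (a : 'I_(nmon d)) :
  \sum_b (if mon d b == mon d a then F (mon d b) else 0) = F (mon d a).
Proof.
rewrite (bigD1 a) //= eqxx big1 ?addr0 // => b ne_ba.
by rewrite (inj_eq (@mon_inj d)) (negPf ne_ba).
Qed.

End Monomials.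

Arguments mon {n} d a.

Lemma nmonE n d : nmon n.+1 d = 'C(d + n, d).
Proof. exact: size_basis. Qed.

Lemma split_mon n (m : 'X_{1..n}) : mdeg m != 0%N ->
  exists l m', m = (U_(l) + m')%MM.
Proof.
move=> m_neq0; have [l m_l] : exists l, m l != 0%N.
  apply/existsP; apply: contraNT m_neq0 => /existsPn m0.
  by rewrite mdegE big1 // => l _; apply/eqP/negPn/m0.
by exists l, (m - U_(l))%MM; rewrite addmC submK // lep1mP.
Qed.

Section Hankel.
Variables (k : fieldType) (n : nat).
Implicit Types phi : 'X_{1..n} -> k.

(** The catalecticant of phi. A functional is encoded as a function on all monomials, of which only
    those of degree i + j matter here; the left kernel consists of the forms of degree i that
    annihilate phi. *)
Definition hankel phi i j : 'M[k]_(nmon n i, nmon n j) :=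
  \matrix_(a, b) phi (mon i a + mon j b)%MM.

(** Contraction by x_l, the adjoint of multiplication by x_l on forms. *)
Definition shift l phi : 'X_{1..n} -> k := fun m => phi (m + U_(l))%MM.

Definition mulvar l d : 'M[k]_(nmon n d, nmon n d.+1) :=
  \matrix_(a, b) (mon d.+1 b == (mon d a + U_(l))%MM)%:R.

Lemma tr_hankel phi i j : (hankel phi i j)^T = hankel phi j i.
Proof. by apply/matrixP => a b; rewrite !mxE addmC. Qed.

Lemma rank_hankelC phi i j : \rank (hankel phi i j) = \rank (hankel phi j i).
Proof. by rewrite -mxrank_tr tr_hankel. Qed.

Lemma sum_delta_mon d m (F : 'X_{1..n} -> k) : mdeg m = d ->
  \sum_a (mon d a == m)%:R * F (mon d a) = F m.
Proof.
case/monP=> c <-; rewrite -[RHS]sum_mon; apply: eq_bigr => a _.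
by case: eqP => _; rewrite ?mul1r ?mul0r.
Qed.

Lemma mulvar_hankel l phi i j :
  mulvar l i *m hankel phi i.+1 j = hankel (shift l phi) i j.
Proof.
apply/matrixP => a b; rewrite !mxE.
under eq_bigr => c _ do rewrite !mxE.
rewrite (@sum_delta_mon i.+1 _ (fun m => phi (m + mon j b)%MM)).
  by rewrite /shift -!addmA (addmC U_(l)%MM).
by rewrite mdegD mdeg1 mdeg_mon addn1.
Qed.

End Hankel.

(** * Concavity *)

Lemma mnmDAC n (m a b : 'X_{1..n}) : (m + a + b = m + b + a)%MM.
Proof. by rewrite -!addmA (addmC a). Qed.

Lemma mdeg3 (m : 'X_{1..3}) : mdeg m = (m 0%R + m 1%R + m 2%R)%N.
Proof.
rewrite mdegE !big_ord_recl big_ord0 addn0 addnA.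
by congr (m _ + m _ + m _)%N; apply: val_inj.
Qed.

Lemma mnm3P (m m' : 'X_{1..3}) :
  mdeg m = mdeg m' -> m 0 = m' 0 -> m 1 = m' 1 -> m = m'.
Proof.
rewrite !mdeg3 => ed e0 e1; have e2 : m 2 = m' 2 by lia.
apply/mnmP => -[[|[|[|//]]] lt_i].
- by rewrite (_ : Ordinal lt_i = 0) //; apply: val_inj.
- by rewrite (_ : Ordinal lt_i = 1) //; apply: val_inj.
- by rewrite (_ : Ordinal lt_i = 2) //; apply: val_inj.
Qed.

Section Contraction.
Variable k : fieldType.
Implicit Types phi : 'X_{1..3} -> k.

(* The action on functionals of the linear form x_l - a x_2. *)
Definition contract l a phi : 'X_{1..3} -> k :=
  fun m => shift l phi m - a * shift 2 phi m.

Definition mulform l a d : 'M[k]_(nmon 3 d, nmon 3 d.+1) :=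
  mulvar k l d - a *: mulvar k 2 d.

Lemma mulform_hankel l a phi i j :
  mulform l a i *m hankel phi i.+1 j = hankel (contract l a phi) i j.
Proof.
rewrite mulmxBl -scalemxAl !mulvar_hankel.
by apply/matrixP => u v; rewrite !mxE.
Qed.

Lemma hankel_mulform l a phi i j :
  hankel phi i j.+1 *m (mulform l a j)^T = hankel (contract l a phi) i j.
Proof. by rewrite -tr_hankel -trmx_mul mulform_hankel tr_hankel. Qed.

Lemma contractC l l' a a' phi m :
  contract l a (contract l' a' phi) m = contract l' a' (contract l a phi) m.
Proof.
rewrite /contract /shift (mnmDAC m U_(l') U_(l))%MM.
rewrite (mnmDAC m U_(2%R) U_(l'))%MM (mnmDAC m U_(2%R) U_(l))%MM; ring.
Qed.

Lemma mulformC l l' a a' d :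
  mulform l a d *m mulform l' a' d.+1 = mulform l' a' d *m mulform l a d.+1.
Proof.
apply/matrixP => u v.
(* The catalecticant of the delta functional at the monomial of index v extracts column v, which
   reduces the claim to [contractC]. *)
pose phi m : k := (m == mon d.+2 v)%:R.
have hankel_delta d' (A : 'M[k]_(d', nmon 3 d.+2)) w :
    (A *m hankel phi d.+2 0) w =1 fun c => A w v.
  move=> c; rewrite mxE (bigD1 v) //= big1 ?addr0 => [|b ne_bv].
    by rewrite !mxE /phi (_ : mon 0 c = 0%MM) ?addm0 ?eqxx ?mulr1 //;
      apply/eqP; rewrite -mdeg_eq0 mdeg_mon.
  rewrite !mxE /phi (_ : mon 0 c = 0%MM) ?addm0; last first.
    by apply/eqP; rewrite -mdeg_eq0 mdeg_mon.
  by rewrite (inj_eq (@mon_inj _ _)) (negPf ne_bv) mulr0.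
have [c _] := @monP 3 0%N 0%MM mdeg0.
rewrite -(hankel_delta _ _ u c) -[RHS](hankel_delta _ _ u c).
rewrite -!mulmxA !mulform_hankel.
by rewrite !mxE contractC.
Qed.

(** In the argument of psi, each x_0 may be traded for a x_2 and each x_1 for b x_2, so psi is a
    multiple of the evaluation at (a, b, 1). *)
Lemma contract_eq0_eval (psi : 'X_{1..3} -> k) a b d :
    (forall m, mdeg m = d -> contract 0 a psi m = 0) ->
    (forall m, mdeg m = d -> contract 1 b psi m = 0) ->
  forall m, mdeg m = d.+1 ->
  psi m = a ^+ m 0 * b ^+ m 1 * psi (U_(2%R) *+ d.+1)%MM.
Proof.
move=> psi_a psi_b.
have red l (m : 'X_{1..3}) : (0 < m l)%N -> m = (m - U_(l) + U_(l))%MM.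
  by move=> m_l; rewrite submK // lep1mP -lt0n.
suff main u v m : mdeg m = d.+1 -> m 0 = u -> m 1 = v ->
    psi m = a ^+ u * b ^+ v * psi (U_(2%R) *+ d.+1)%MM.
  by move=> m dm; apply: main.
elim: u v m => [|u IHu].
  elim=> [|v IHv] m dm m0 m1.
    rewrite !mul1r; congr psi; apply: mnm3P.
    - by rewrite dm mdegMn mdeg1 mul1n.
    - by rewrite m0 mulmnE mnm1E.
    - by rewrite m1 mulmnE mnm1E.
  have /red em : (0 < m 1%R)%N by rewrite m1.
  set m' := (m - U_(1%R))%MM in em.
  have dm' : mdeg m' = d by move: dm; rewrite em mdegD mdeg1 addn1 => -[].
  have /eqP := psi_b m' dm'.
  rewrite /contract /shift subr_eq0 -em => /eqP ->.
  rewrite (IHv (m' + U_(2%R))%MM).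
  - by rewrite exprS; ring.
  - by rewrite mdegD mdeg1 dm' addn1.
  - by move: m0; rewrite {1}em !mnmDE !mnm1E.
  - by move: m1; rewrite {1}em !mnmDE !mnm1E /= => ?; lia.
move=> v m dm m0 m1.
have /red em : (0 < m 0%R)%N by rewrite m0.
set m' := (m - U_(0%R))%MM in em.
have dm' : mdeg m' = d by move: dm; rewrite em mdegD mdeg1 addn1 => -[].
have /eqP := psi_a m' dm'.
rewrite /contract /shift subr_eq0 -em => /eqP ->.
rewrite (IHu v (m' + U_(2%R))%MM).
- by rewrite exprS; ring.
- by rewrite mdegD mdeg1 dm' addn1.
- by move: m0; rewrite {1}em !mnmDE !mnm1E /= => ?; lia.
- by move: m1; rewrite {1}em !mnmDE !mnm1E.
Qed.

(* If f is a form of degree t with f(a, b, 1) <> 0 that annihilates phi, then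
   x_1 - b x_2 acts injectively on the functionals in the row space of
   [hankel phi i j.+2] that are killed by x_0 - a x_2: those it kills are
   multiples of the evaluation at (a, b, 1), and f kills them too. *)
Lemma rank_contract_le phi a b t (x : 'rV[k]_(nmon 3 t)) i j :
    (t <= j.+2)%N ->
    \sum_c x 0 c * (a ^+ mon t c 0%R * b ^+ mon t c 1%R) != 0 ->
    (forall m, mdeg m = (i + (j.+2 - t))%N ->
       \sum_c x 0 c * phi (mon t c + m)%MM = 0) ->
  (\rank (hankel phi i j.+2) + \rank (hankel (contract 0%R a phi) i.+1 j) <=
   \rank (hankel phi i.+1 j.+1) + \rank (hankel (contract 0%R a phi) i j.+1))%N.
Proof.
move=> le_t x_ab x_phi.
pose A := hankel phi i j.+2; pose CL := (mulform 0 a j.+1)^T.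
pose Cu := (mulform 1 b j.+1)^T.
pose A' := hankel phi i.+1 j.+1; pose CL' := (mulform 0 a j)^T.
have -> : \rank A = (\rank (hankel (contract 0%R a phi) i j.+1) +
    \rank (A :&: kermx CL)%MS)%N.
  by rewrite -hankel_mulform mxrank_mul_ker.
have -> : \rank A' = (\rank (hankel (contract 0%R a phi) i.+1 j) +
    \rank (A' :&: kermx CL')%MS)%N.
  by rewrite -hankel_mulform mxrank_mul_ker.
suff: (\rank (A :&: kermx CL)%MS <= \rank (A' :&: kermx CL')%MS)%N by lia.
have /eqP/mxrank_injP <- : ((A :&: kermx CL) :&: kermx Cu)%MS = 0.
  apply/eqP/rowV0P => v; rewrite !sub_capmx => /andP[/andP[/submxP[y def_v] vL] vu].
  pose psi m := \sum_c y 0 c * phi (mon i c + m)%MM.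
  have v_psi c : v 0 c = psi (mon _ c).
    by rewrite def_v !mxE; apply: eq_bigr => d _; rewrite !mxE.
  have contr l e : (v <= kermx (mulform l e j.+1)^T)%MS ->
      forall m, mdeg m = j.+1 -> contract l e psi m = 0.
    rewrite sub_kermx def_v -mulmxA hankel_mulform => /eqP/rowP vl m.
    case/monP=> c <-; have := vl c; rewrite !mxE => <-.
    rewrite /contract /shift /psi mulr_sumr -sumrB.
    by apply: eq_bigr => d _; rewrite !mxE /contract /shift !addmA; ring.
  have psiE := contract_eq0_eval (contr _ _ vL) (contr _ _ vu).
  have psi0 : psi (U_(2%R) *+ j.+2)%MM = 0.
    apply/eqP; rewrite -(mulrI_eq0 _ (mulfI x_ab)); apply/eqP.
    (* Apply f times a power of x_2 to psi: since psi is a multiple of an evaluation, this gives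
       f(a, b, 1) times the value of psi at x_2^(j+2); it vanishes because f annihilates phi, hence
       psi. *)
    transitivity (\sum_c x 0 c * psi (mon t c + U_(2%R) *+ (j.+2 - t))%MM).
      rewrite mulr_suml; apply: eq_bigr => c _; rewrite -mulrA.
      rewrite (psiE (mon t c + _)%MM); last first.
        by rewrite mdegD mdegMn mdeg1 mul1n mdeg_mon subnKC.
      by rewrite !mnmDE !mulmnE !mnm1E !mul0n !addn0 /= -!mulrA.
    rewrite /psi; under eq_bigr do rewrite mulr_sumr.
    rewrite exchange_big big1 //= => d _.
    under eq_bigr do rewrite mulrCA (addmC (mon i d)) -addmA.
    rewrite -mulr_sumr x_phi ?mulr0 //.
    by rewrite mdegD mdeg_mon mdegMn mdeg1 mul1n addnC.
  apply/rowP => c; rewrite v_psi mxE psiE ?mdeg_mon //.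
  by rewrite psi0 mulr0.
(* The image under x_1 - b x_2 lies in the row space of [A'] and, as the two linear forms commute,
   is still killed by x_0 - a x_2. *)
rewrite mxrankS // sub_capmx; apply/andP; split.
  rewrite (submx_trans (submxMr _ (capmxSl _ _))) //.
  by rewrite hankel_mulform -mulform_hankel submxMl.
rewrite sub_kermx -mulmxA /CL' /Cu -trmx_mul mulformC trmx_mul mulmxA.
have /sub_kermxP -> := capmxSr A (kermx CL).
by rewrite mul0mx.
Qed.

End Contraction.

(** * Adding general points *)

(** Multiplying by x shows that v lies in the new row space, hence so does G; y shows that v is not
    in the row space of G. *)
Lemma rank_add_rank1 (k : fieldType) m n (G : 'M[k]_(m, n)) (u : 'cV_m)
    (v : 'rV_n) (x : 'rV_m) (y : 'cV_n) :
    x *m G = 0 -> G *m y = 0 -> x *m u != 0 -> v *m y != 0 ->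
  forall c, c != 0 -> (\rank G < \rank (G + c *: (u *m v))%R)%N.
Proof.
move=> xG0 Gy0 xu_neq0 vy_neq0 c c_neq0; set G' := (G + _)%R.
have v_sub : (v <= G')%MS.
  have : (x *m G' <= G')%MS by apply: submxMl.
  rewrite mulmxDr xG0 add0r -scalemxAr mulmxA [x *m u]mx11_scalar mul_scalar_mx.
  rewrite scalerA eqmx_scale // mulf_neq0 //; apply: contraNneq xu_neq0 => xu0.
  by rewrite [x *m u]mx11_scalar xu0 raddf0.
have G_sub : (G <= G')%MS.
  rewrite -{1}[G](addrK (c *: (u *m v))) addmx_sub // eqmx_opp scalemx_sub //.
  by rewrite (submx_trans _ v_sub) ?submxMl.
rewrite ltn_neqAle mxrankS // andbT.
rewrite (eq_leqif (mxrank_leqif_sup G_sub)).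
apply: contraNN vy_neq0 => /(submx_trans v_sub)/submxP[w ->].
by rewrite -mulmxA Gy0 mulmx0.
Qed.

Lemma rank_add_rank1_ge (k : fieldType) m n (G : 'M[k]_(m, n)) (u : 'cV_m)
    (v : 'rV_n) :
  exists2 p : {poly k}, p != 0 &
    forall c, p.[c] != 0 -> (\rank G <= \rank (G + c *: (u *m v))%R)%N.
Proof.
(* If some c0 lowers the rank, the rank-one term is independent of what is
   left, so every other c restores the rank. *)
have [good|] := pselect (forall c, \rank G <= \rank (G + c *: (u *m v))%R)%N.
  by exists 1; rewrite ?oner_eq0.
move/existsNP=> [c0 /negP]; rewrite -ltnNge; set G0 := (G + _)%R => bad.
have defG : G = G0 - c0 *: (u *m v) by rewrite addrK.
have v_nsub : ~~ (v <= G0)%MS.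
  apply: contraL bad => v_sub; rewrite -leqNgt mxrankS // defG.
  rewrite addmx_sub // eqmx_opp scalemx_sub //.
  by rewrite (submx_trans _ v_sub) ?submxMl.
have u_nsub : ~~ (u^T <= G0^T)%MS.
  apply: contraL bad => u_sub; rewrite -leqNgt -mxrank_tr -[leqRHS]mxrank_tr.
  rewrite mxrankS // defG linearB linearZ /= trmx_mul.
  rewrite addmx_sub // eqmx_opp scalemx_sub //.
  by rewrite (submx_trans _ u_sub) ?submxMl.
have [y Gy vy] : exists2 y : 'cV_n, G0 *m y = 0 & v *m y != 0.
  move: v_nsub; rewrite submxE => /matrix0Pn[i [j nz]].
  exists (col j (cokermx G0)); first by rewrite colE mulmxA mulmx_coker mul0mx.
  rewrite colE mulmxA -colE; apply/eqP => /colP/(_ i); rewrite !mxE => e.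
  by move: nz; rewrite !mxE e eqxx.
have [x Gx ux] : exists2 y : 'cV_m, G0^T *m y = 0 & u^T *m y != 0.
  move: u_nsub; rewrite submxE => /matrix0Pn[i [j nz]].
  exists (col j (cokermx G0^T)); first by rewrite colE mulmxA mulmx_coker mul0mx.
  rewrite colE mulmxA -colE; apply/eqP => /colP/(_ i); rewrite !mxE => e.
  by move: nz; rewrite !mxE e eqxx.
have xG : x^T *m G0 = 0 by rewrite -[G0]trmxK -trmx_mul Gx trmx0.
have xu : x^T *m u != 0.
  apply: contraNneq ux => e.
  by rewrite -[x]trmxK -trmx_mul e trmx0.
exists ('X - c0%:P); first by rewrite polyXsubC_eq0.
move=> c; rewrite !hornerE => c_neq.
have := rank_add_rank1 xG Gy xu vy c_neq.
have -> : G0 + (c - c0) *: (u *m v) = G + c *: (u *m v).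
  by rewrite /G0 -addrA -scalerDl [(c0 + _)%R]addrC subrK.
have : (\rank G <= (\rank G0).+1)%N.
  rewrite {1}defG (leq_trans (mxrank_add _ _)) // -[leqRHS]addn1 leq_add2l mxrank_opp.
  rewrite (leq_trans (mxrank_scale _ _)) // (leq_trans (mxrankM_maxl _ _)) //.
  exact: rank_leq_col.
by move=> /leq_trans; apply.
Qed.

(** The rank of the matrix of a map is the number of its values, listed by E: the map factors
    through E as a surjection followed by an injection. *)
Lemma rank_fibers (k : fieldType) m D (f : 'I_m -> nat) (E : seq nat) :
    uniq E -> (forall c, reflect (exists a, f a = c) (c \in E)) ->
    (forall a, f a < D)%N ->
  \rank (\matrix_(a < m, c < D) (f a == c)%:R : 'M[k]_(m, D)) = size E.
Proof.
move=> uE memE f_lt.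
pose N := size E; pose e (b : 'I_N) := nth 0%N E b.
pose A : 'M[k]_(m, N) := \matrix_(a, b) (f a == e b)%:R.
pose B : 'M[k]_(N, D) := \matrix_(b, c) (e b == c)%:R.
have e_inj : injective e.
  by move=> b b' /eqP; rewrite nth_uniq // => /eqP/val_inj.
have ind (a : 'I_m) : {b | e b = f a}.
  have fa_in : f a \in E by apply/memE; exists a.
  have lt_a : (index (f a) E < N)%N by rewrite index_mem.
  by exists (Ordinal lt_a); rewrite /e /= nth_index.
have sect (b : 'I_N) : {a | f a = e b}.
  by apply: cid; apply/memE; apply: mem_nth.
have -> : \matrix_(a < m, c < D) (f a == c)%:R = A *m B.
  apply/matrixP => a c; rewrite !mxE; have [b eb] := ind a.
  rewrite (bigD1 b) //= big1 ?addr0 => [|b' ne_b].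
    by rewrite !mxE eb eqxx mul1r.
  by rewrite !mxE -eb (inj_eq e_inj) eq_sym (negPf ne_b) mul0r.
have B_free : row_free B.
  apply/row_freeP; exists B^T; apply/matrixP => b b'; rewrite !mxE.
  have [a ea] := sect b.
  have eb_lt : (e b < D)%N by rewrite -ea.
  rewrite (bigD1 (Ordinal eb_lt)) //= big1 ?addr0 => [|c ne_c].
    by rewrite !mxE /= eqxx mul1r (inj_eq e_inj) eq_sym.
  rewrite !mxE (_ : (e b == c) = false) ?mul0r //.
  by apply: contraNF ne_c => /eqP ebc; apply/eqP/val_inj.
rewrite mxrankMfree //.
suff : row_free A^T by rewrite -mxrank_tr => /eqP.
apply/row_freeP; exists (\matrix_(a, b) (a == sval (sect b))%:R).
apply/matrixP => b b'; rewrite !mxE; have [a ea] := sect b'.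
rewrite (bigD1 (sval (sect b'))) //= big1 ?addr0 => [|c ne_c].
  rewrite !mxE eqxx mulr1; case: (sect b') => /= c ->.
  by rewrite (inj_eq e_inj) eq_sym.
by rewrite !mxE (negPf ne_c) mulr0.
Qed.

(** In characteristic zero the integers below the size of p are distinct in k, and too many to be
    all roots. *)
Lemma exists_nonroot (k : fieldType) (char_k : [pchar k] =i pred0)
  (p : {poly k}) : p != 0 -> exists s, p.[s] != 0.
Proof.
move=> p_neq0; set N := size p.
pose rs := [seq i%:R | i <- iota 0 N] : seq k.
have rs_uniq : uniq rs.
  rewrite map_inj_uniq ?iota_uniq // => i j.
  wlog le_ij : i j / (i <= j)%N => [IH|].
    by case/orP: (leq_total i j) => [/IH//|/IH ih /esym/ih].
  move/eqP; rewrite eq_sym -subr_eq0 -natrB // => /eqP eq0.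
  apply/eqP; rewrite eqn_leq le_ij -subn_eq0.
  by rewrite -((pcharf0P k).1 char_k) eq0 eqxx.
have : ~~ all (root p) rs.
  apply/negP => /(max_poly_roots p_neq0)/(_ rs_uniq).
  by rewrite size_map size_iota ltnn.
by case/allPn => s _ ?; exists s.
Qed.

(** Genericity is expressed by the nonvanishing of a nonzero polynomial; finitely many such
    conditions are met together by taking the product. *)
Lemma exists_nonroots (k : fieldType) (P : nat -> k -> Prop) :
    (forall i, exists2 p : {poly k}, p != 0 & forall s, p.[s] != 0 -> P i s) ->
  forall d, exists2 p : {poly k}, p != 0 &
    forall s, p.[s] != 0 -> forall i, (i < d)%N -> P i s.
Proof.
move=> exP; elim=> [|d [p p_neq0 pP]]; first by exists 1; rewrite ?oner_eq0.
have [q q_neq0 qP] := exP d.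
exists (p * q); first by rewrite mulf_neq0.
move=> s; rewrite hornerM mulf_eq0 negb_or => /andP[ps qs] i.
by rewrite ltnS leq_eqVlt => /predU1P[->|]; [apply: qP | apply: pP].
Qed.

Section Curve.
Variable k : fieldType.
Implicit Types (phi : 'X_{1..3} -> k) (s : k).

(* The monomial m takes the value [s ^+ kappa K m] at the point (s, s^K, 1). *)
Definition kappa K (m : 'X_{1..3}) := (m 0%R + K * m 1%R)%N.

(** The restriction of forms to the curve: x times this matrix lists the coefficients in s of the
    form x evaluated at (s, s^K, 1). The number of columns only has to exceed all exponents. *)
Definition expmx K d : 'M[k]_(nmon 3 d, (K.+1 * d).+1) :=
  \matrix_(a, c) (kappa K (mon d a) == c)%:R.

Definition curve_ev K s d : 'cV[k]_(nmon 3 d) :=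
  \col_a s ^+ kappa K (mon d a).

Lemma kappaD K m m' : kappa K (m + m') = (kappa K m + kappa K m')%N.
Proof. by rewrite /kappa !mnmDE; lia. Qed.

Lemma kappa_lt K d a : (kappa K (mon d a) < (K.+1 * d).+1)%N.
Proof.
rewrite ltnS /kappa; have := mdeg_mon a; rewrite mdeg3 => ed.
by rewrite mulSn; apply: leq_add; [lia|rewrite leq_mul2l; lia].
Qed.

(** The exponent of x_0 is at most d < K, so [kappa] is an expansion in base K. Hence no nonzero
    form of degree d vanishes on the curve. *)
Lemma kappa_inj K d : (d < K)%N -> injective (fun a => kappa K (mon d a)).
Proof.
move=> lt_d a b; rewrite /kappa => eqk; apply: mon_inj.
have := mdeg_mon a; have := mdeg_mon b; rewrite !mdeg3 => eb ea.
have e1 : mon d a 1 = mon d b 1.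
  by case: (ltngtP (mon d a 1) (mon d b 1)) => // lt; nia.
by apply: mnm3P => //; rewrite ?mdeg_mon //; lia.
Qed.

Lemma rank_expmx_inj K d : (d < K)%N -> \rank (expmx K d) = nmon 3 d.
Proof.
move=> lt_d.
rewrite (@rank_fibers _ _ _ _ [seq kappa K (mon d a) | a <- enum 'I_(nmon 3 d)]).
- by rewrite size_map size_enum_ord.
- by rewrite map_inj_uniq ?enum_uniq //; apply: kappa_inj.
- move=> c; apply: (iffP mapP) => [[a _ ->]|[a <-]]; exists a => //.
  by rewrite mem_enum.
- exact: kappa_lt.
Qed.

Lemma curve_poly K d (x : 'rV[k]_(nmon 3 d)) : x *m expmx K d != 0 ->
  exists2 p : {poly k}, p != 0 & forall s, p.[s] = (x *m curve_ev K s d) 0 0.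
Proof.
move=> xQ; exists (rVpoly (x *m expmx K d)).
  by apply: contraNneq xQ => e; rewrite -[x *m _]rVpolyK e raddf0.
move=> s; rewrite (horner_coef_wide _ (size_poly _ _)).
under eq_bigr => c _ do rewrite coef_rVpoly_ord mxE mulr_suml.
rewrite exchange_big mxE; apply: eq_bigr => a _ /=.
rewrite (bigD1 (Ordinal (kappa_lt K a))) //= big1 ?addr0 => [|c ne_c].
  by rewrite !mxE eqxx mulr1.
rewrite !mxE (_ : (_ == _) = false) ?mulr0 ?mul0r //.
by apply: contraNF ne_c => /eqP e; apply/eqP/val_inj.
Qed.

(* Adds c times the evaluation at (s, s^K, 1). *)
Definition add_point K c s phi : 'X_{1..3} -> k :=
  fun m => phi m + c * s ^+ kappa K m.

Lemma hankel_add_point K c s phi i j :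
  hankel (add_point K c s phi) i j =
  hankel phi i j + c *: (curve_ev K s i *m (curve_ev K s j)^T).
Proof.
apply/matrixP => a b; rewrite !mxE big_ord1 !mxE /add_point.
by rewrite kappaD exprD.
Qed.

(** Serves to bound the rank contributed by points of the curve by that of [expmx], however many
    points are added. *)
Lemma curve_ev_sub K s d :
  exists y, curve_ev K s d = expmx K d *m y.
Proof.
exists (\col_c s ^+ c); apply/matrixP => a b; rewrite !mxE.
rewrite (bigD1 (Ordinal (kappa_lt K a))) //= big1 ?addr0 => [|c ne_c].
  by rewrite !mxE eqxx mul1r.
rewrite !mxE (_ : (_ == _) = false) ?mul0r //.
by apply: contraNF ne_c => /eqP e; apply/eqP/val_inj.
Qed.

(** The rows of C span a space of forms. By counting ranks, some form in it is killed by G but does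
    not vanish on the curve. *)
Lemma expmx_detect K d n (G : 'M[k]_(nmon 3 d, n)) m (C : 'M_(m, nmon 3 d)) :
    (\rank (C *m G) < \rank (C *m expmx K d))%N ->
  exists2 x : 'rV_m, x *m (C *m G) = 0 & (x *m C) *m expmx K d != 0.
Proof.
move=> lt_r.
have : kermx (C *m G) *m (C *m expmx K d) != 0.
  apply/eqP => /mulmx0_rank_max; rewrite mxrank_ker.
  have := rank_leq_row (C *m G); lia.
case/matrix0Pn => i [j nz]; exists (row i (kermx (C *m G))).
  by rewrite -row_mul mulmx_ker row0.
rewrite -!row_mul -mulmxA; apply/eqP => /rowP/(_ j); rewrite !mxE => e.
by move: nz; rewrite !mxE e eqxx.
Qed.

(** As long as the rank is not maximal, both kernels contain forms not vanishing on the curve; at a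
    general point neither of them vanishes, and [rank_add_rank1] applies. *)
Lemma rank_add_point_lt K phi i j m (C : 'M_(m, nmon 3 i)) :
    (\rank (C *m hankel phi i j) <
      minn (\rank (C *m expmx K i)) (\rank (expmx K j)))%N ->
  exists2 p : {poly k}, p != 0 & forall s, p.[s] != 0 -> forall c, c != 0 ->
    (\rank (C *m hankel phi i j) <
     \rank (C *m hankel (add_point K c s phi) i j))%N.
Proof.
rewrite leq_min => /andP[lt_i lt_j].
have [x xG xQ] := expmx_detect lt_i.
have [y yG yQ] : exists2 y : 'rV_(nmon 3 j),
    y *m (1%:M *m (C *m hankel phi i j)^T) = 0 & (y *m 1%:M) *m expmx K j != 0.
  by apply: expmx_detect; rewrite !mul1mx mxrank_tr.
have [p p_neq0 pE] := curve_poly xQ; have [q q_neq0 qE] := curve_poly yQ.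
exists (p * q); first by rewrite mulf_neq0.
move=> s; rewrite hornerM mulf_eq0 negb_or pE qE => /andP[ps qs] c c_neq0.
rewrite hankel_add_point mulmxDr -scalemxAr mulmxA.
apply: (rank_add_rank1 (x := x) (y := y^T)) => //.
- by apply: trmx_inj; rewrite trmx_mul trmxK trmx0 -[RHS]yG mul1mx.
- by apply: contraNneq ps; rewrite mulmxA => ->; rewrite mxE.
- apply: contraNneq qs; rewrite mulmx1 -trmx_mul => /(congr1 trmx).
  by rewrite trmxK trmx0 => ->; rewrite mxE.
Qed.

Lemma exists_add_point (char_k : [pchar k] =i pred0) K phi d
    (C : forall i, 'M[k]_(nmon 3 i)) :
  exists c s, forall i, (i <= d)%N ->
    (minn (minn (\rank (C i *m expmx K i)) (\rank (expmx K (d - i))))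
       (\rank (C i *m hankel phi i (d - i))).+1 <=
     \rank (C i *m hankel (add_point K c s phi) i (d - i)))%N.
Proof.
have [i|p p_neq0 pP] := @exists_nonroots k (fun i s => forall c, c != 0 ->
    (\rank (C i *m hankel phi i (d - i)) <
      minn (\rank (C i *m expmx K i)) (\rank (expmx K (d - i))))%N ->
    (\rank (C i *m hankel phi i (d - i)) <
      \rank (C i *m hankel (add_point K c s phi) i (d - i)))%N) _ d.+1.
  case: (ltnP (\rank (C i *m hankel phi i (d - i))) (minn _ _)) => [lt_r|_].
    have [p p_neq0 pP] := rank_add_point_lt lt_r.
    by exists p => // s /pP ps c c_neq0 _; apply: ps.
  by exists 1; rewrite ?oner_eq0.
have [s ps] := exists_nonroot char_k p_neq0.
(* A rank that is already maximal must at least not drop; this restricts c once s is chosen. The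
   factor ['X] below makes c nonzero. *)
have [i|q q_neq0 qP] := @exists_nonroots k (fun i c =>
    (\rank (C i *m hankel phi i (d - i)) <=
      \rank (C i *m hankel (add_point K c s phi) i (d - i)))%N) _ d.+1.
  have [q q_neq0 qP] := rank_add_rank1_ge (C i *m hankel phi i (d - i))
    (C i *m curve_ev K s i) (curve_ev K s (d - i))^T.
  exists q => // c /qP.
  by rewrite hankel_add_point mulmxDr -scalemxAr mulmxA.
have [c] : exists c, ('X * q).[c] != 0.
  by apply: exists_nonroot => //; rewrite mulf_neq0 ?polyX_eq0.
rewrite hornerM hornerX mulf_eq0 negb_or => /andP[c_neq0 qc].
exists c, s => i le_i.
have [le_b|lt_r] := leqP (minn (\rank (C i *m expmx K i)) (\rank (expmx K (d - i))))
  (\rank (C i *m hankel phi i (d - i))).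
  by rewrite geq_min (leq_trans le_b) // qP.
by rewrite geq_min pP // orbT.
Qed.

Lemma exists_add_points (char_k : [pchar k] =i pred0) K n phi0 d
    (C : forall i, 'M[k]_(nmon 3 i)) :
  exists phi, forall i, (i <= d)%N ->
    (minn (minn (\rank (C i *m expmx K i)) (\rank (expmx K (d - i))))
       (\rank (C i *m hankel phi0 i (d - i)) + n) <=
     \rank (C i *m hankel phi i (d - i)))%N /\
    (\rank (hankel phi i (d - i)) <=
     \rank (hankel phi0 i (d - i)) + minn n (\rank (expmx K i)))%N.
Proof.
(* For the upper bound, the induction keeps the total correction as a product with [expmx], so its
   rank is bounded both by n and by the rank of [expmx]. *)
suff [phi phiP] : exists phi, forall i, (i <= d)%N ->
    (minn (minn (\rank (C i *m expmx K i)) (\rank (expmx K (d - i))))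
       (\rank (C i *m hankel phi0 i (d - i)) + n) <=
     \rank (C i *m hankel phi i (d - i)))%N /\
    (exists2 D, hankel phi i (d - i) = hankel phi0 i (d - i) + expmx K i *m D &
      (\rank (expmx K i *m D) <= n)%N).
  exists phi => i /phiP[ge_r [D eD le_D]]; split=> //.
  rewrite eD (leq_trans (mxrank_add _ _)) // leq_add2l leq_min le_D.
  exact: mxrankM_maxl.
elim: n => [|n [phi phiP]].
  exists phi0 => i _; rewrite addn0 geq_minr; split=> //.
  by exists 0; rewrite ?mulmx0 ?addr0 ?mxrank0.
have [c [s csP]] := exists_add_point char_k K phi d C.
exists (add_point K c s phi) => i le_i.
have [ge_r [D eD le_D]] := phiP i le_i; split; first by have := csP i le_i; lia.
have [y ey] := curve_ev_sub K s i.
exists (D + c *: (y *m (curve_ev K s (d - i))^T)).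
  by rewrite hankel_add_point eD mulmxDr -scalemxAr mulmxA -ey addrA.
rewrite mulmxDr -scalemxAr mulmxA -ey (leq_trans (mxrank_add _ _)) //.
rewrite -[n.+1]addn1 leq_add // (leq_trans (mxrank_scale _ _)) //.
by rewrite (leq_trans (mxrankM_maxl _ _)) // rank_leq_col.
Qed.

End Curve.

(** * Hilbert functions of Gorenstein algebras *)

Section Gorenstein.
Variable k : fieldType.
Implicit Types phi : 'X_{1..3} -> k.

(* The Hilbert function of the Gorenstein algebra of socle degree e with
   Macaulay dual generator phi. *)
Definition gor_hilb phi e i := \rank (hankel phi i (e - i)).

Lemma gor_hilb_sym phi e i : (i <= e)%N -> gor_hilb phi e (e - i) = gor_hilb phi e i.
Proof. by move=> le_i; rewrite /gor_hilb subKn // rank_hankelC. Qed.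

Lemma gor_hilb_le phi e i : (gor_hilb phi e i <= nmon 3 i)%N.
Proof. exact: rank_leq_row. Qed.

Lemma gor_hilb_concave (char_k : [pchar k] =i pred0) phi e t i :
    (t <= e)%N -> (gor_hilb phi e t < nmon 3 t)%N ->
    (i.+2 <= e)%N -> (t <= i.+2)%N -> (t <= e - i)%N ->
  (gor_hilb phi e i.+2 + gor_hilb phi e i <= (gor_hilb phi e i.+1).*2)%N.
Proof.
move=> le_te lt_t le_ie le_ti le_tei.
(* x is a form of degree t annihilating phi. With exponent t + 1 it cannot vanish on the whole
   curve, which provides the point (a, b, 1). *)
have [x x_phi xQ] : exists2 x : 'rV_(nmon 3 t),
    x *m (1%:M *m hankel phi t (e - t)) = 0 &
    (x *m 1%:M) *m expmx k t.+1 t != 0.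
  by apply: expmx_detect; rewrite !mul1mx rank_expmx_inj.
have [p p_neq0 pE] := curve_poly xQ.
have [s ps] := exists_nonroot char_k p_neq0.
pose a := s; pose b := s ^+ t.+1.
have x_ab : \sum_c x 0 c * (a ^+ mon t c 0%R * b ^+ mon t c 1%R) != 0.
  rewrite (_ : \sum_c _ = p.[s]) // pE mulmx1 mxE; apply: eq_bigr => c _.
  by rewrite !mxE /kappa exprD exprM.
have x_ann m : mdeg m = (e - t)%N -> \sum_c x 0 c * phi (mon t c + m)%MM = 0.
  case/monP=> d <-; move/rowP: x_phi => /(_ d); rewrite mul1mx !mxE => x0; rewrite -[RHS]x0.
  by apply: eq_bigr => c _; rewrite !mxE.
pose j := (e - i.+2)%N.
have ej : (e - i.+1 = j.+1)%N by lia.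
have ei : (e - i = j.+2)%N by lia.
rewrite /gor_hilb ej ei.
have x_ann' u v m : mdeg m = (u + (v.+2 - t))%N ->
    (u + v)%N = (i + j)%N -> (t <= v.+2)%N ->
    \sum_c x 0 c * phi (mon t c + m)%MM = 0.
  by move=> dm euv le_v; apply: x_ann; lia.
have h1 : (\rank (hankel phi i j.+2) + \rank (hankel (contract 0%R a phi) i.+1 j) <=
   \rank (hankel phi i.+1 j.+1) + \rank (hankel (contract 0%R a phi) i j.+1))%N.
  by apply: (rank_contract_le _ x_ab) => [|m /x_ann']; [lia | apply; lia].
(* The same inequality from the other end. In the sum of both, the ranks of the contracted
   functional cancel by symmetry of the catalecticants. *)
have h2 : (\rank (hankel phi j i.+2) + \rank (hankel (contract 0%R a phi) j.+1 i) <=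
   \rank (hankel phi j.+1 i.+1) + \rank (hankel (contract 0%R a phi) j i.+1))%N.
  by apply: (rank_contract_le _ x_ab) => [|m /x_ann']; [lia | apply; lia].
rewrite (rank_hankelC _ j i.+2) (rank_hankelC _ j.+1 i) in h2.
rewrite (rank_hankelC _ j.+1 i.+1) (rank_hankelC _ j i.+1) in h2.
rewrite -addnn -(leq_add2r (\rank (hankel (contract 0%R a phi) i.+1 j) +
  \rank (hankel (contract 0%R a phi) i j.+1))) -/j.
by apply: leq_trans (leq_trans (leq_add h1 h2) _); lia.
Qed.

End Gorenstein.

(* The Hilbert function of a plane curve of degree r. *)
Definition curve_hilb r d := (\sum_(l < d.+1) minn l.+1 r)%N.

Lemma curve_hilbS r d : curve_hilb r d.+1 = (curve_hilb r d + minn d.+2 r)%N.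
Proof. by rewrite /curve_hilb big_ord_recr. Qed.

(** On the curve, x_0^r equals x_1 x_2^(r-1). So the exponents that occur are the numbers a + r b
    with a < r and a + b <= d, each obtained once. *)
Lemma rank_expmx (k : fieldType) r d : (0 < r)%N ->
  \rank (expmx k r d) = curve_hilb r d.
Proof.
move=> r_gt0.
pose E := [seq (a + r * b)%N | b <- iota 0 d.+1, a <- iota 0 (minn r (d.+1 - b))].
rewrite (@rank_fibers _ _ _ _ E).
- rewrite size_allpairs_dep sumnE big_map -[iota 0 _]/(index_iota 0 d.+1) big_mkord.
  rewrite (reindex_inj rev_ord_inj); apply: eq_bigr => l _ /=.
  by rewrite size_iota minnC; have := ltn_ord l; lia.
- apply: allpairs_uniq_dep => [|b _|]; try exact: iota_uniq.
  move=> p q /allpairsPdep[b1 [a1 [_ lt_a1 ->]]].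
  move=> /allpairsPdep[b2 [a2 [_ lt_a2 ->]]] /= eqE.
  move: lt_a1 lt_a2; rewrite !mem_iota => lt_a1 lt_a2.
  have eb : b1 = b2 by case: (ltngtP b1 b2) => // lt_b; nia.
  by subst b2; have -> : a1 = a2 by lia.
- move=> c; apply: (iffP allpairsPdep) => [[b [a []]]|[u <-]].
    rewrite !mem_iota => /andP[_ lt_b] /andP[_ lt_a] ->.
    pose m := (U_(0%R) *+ a + U_(1%R) *+ b + U_(2%R) *+ (d - a - b))%MM : 'X_{1..3}.
    have [|u um] := @monP 3 d m.
      by rewrite !mdegD !mdegMn !mdeg1; lia.
    exists u; rewrite um /kappa /m !mnmDE !mulmnE !mnm1E /=; lia.
  have := mdeg_mon u; rewrite mdeg3; set x := _ 0; set y := _ 1 => dm.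
  exists (y + x %/ r)%N, (x %% r)%N; rewrite !mem_iota.
  have ex := divn_eq x r; have lt_m := ltn_pmod x r_gt0.
  have le_q := leq_pmulr (x %/ r) r_gt0.
  rewrite /kappa -/x -/y mulnDr [(r * (x %/ r))%N]mulnC.
  move: ex lt_m le_q dm; move: (x %/ r)%N (x %% r)%N => q w.
  by move: (q * r)%N (r * y)%N => qr ry ex lt_m le_q dm; split; lia.
- exact: kappa_lt.
Qed.

(** * Macaulay duality *)

Section HasDim.
Variables (k : fieldType) (V : lmodType k).
Implicit Types U : set V.

Lemma has_dim_le U m n : has_dim U m -> has_dim U n -> (m <= n)%N.
Proof.
move=> [b [Ub b_free _]] [b' [_ _ b'_span]].
have /choice[C CP] i : exists c : 'I_n -> k, b i = \sum_j c j *: b' j.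
  exact/b'_span/Ub.
pose A : 'M[k]_(m, n) := \matrix_(i, j) C i j.
suff /eqP <- : row_free A by apply: rank_leq_col.
apply: inj_row_free => v vA0; apply/rowP => i; rewrite mxE.
apply: b_free; under eq_bigr => j _ do rewrite CP scaler_sumr.
rewrite exchange_big big1 //= => j _.
under eq_bigr => l _ do rewrite scalerA.
have e : \sum_l v 0 l * C l j = (v *m A) 0 j.
  by rewrite mxE; apply: eq_bigr => l _; rewrite mxE.
by rewrite -scaler_suml e vA0 mxE scale0r.
Qed.

Lemma has_dim_inj U m n : has_dim U m -> has_dim U n -> m = n.
Proof.
by move=> Um Un; apply/eqP; rewrite eqn_leq !(has_dim_le (U := U)).
Qed.

Lemma has_dim0 U u : has_dim U 0 -> U u -> u = 0.
Proof. by move=> [b [_ _ span]] /span[c ->]; rewrite big_ord0. Qed.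

(** Rank-nullity: a basis of a complement of M in S maps to a basis of the image. *)
Lemma has_dim_image n (T : {linear 'rV[k]_n -> V}) (M S : 'M_n) :
    (M <= S)%MS -> (forall v, T v = 0 <-> (v <= M)%MS) ->
  has_dim [set T v | v in [set v | (v <= S)%MS]] (\rank S - \rank M).
Proof.
move=> MS kerT; pose D := (S :\: M)%MS.
have -> : (\rank S - \rank M)%N = \rank D.
  by rewrite -(mxrank_cap_compl S M) (capmx_idPr MS) addKn.
have comb c : \sum_i c i *: T (row i (row_base D)) =
    T ((\row_i c i) *m row_base D).
  rewrite mulmx_sum_row linear_sum; apply: eq_bigr => i _.
  by rewrite linearZ mxE.
exists (fun i => T (row i (row_base D))); split.
- move=> i; exists (row i (row_base D)) => //=.
  by rewrite (submx_trans (row_sub _ _)) // eq_row_base diffmxSl.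
- move=> c; rewrite comb => /kerT cM i.
  have : ((\row_i c i) *m row_base D <= D :&: M)%MS.
    by rewrite sub_capmx cM andbT (submx_trans (submxMl _ _)) ?eq_row_base.
  rewrite /D capmx_diff submx0 mulmx_free_eq0 ?row_base_free // => /eqP/rowP.
  by move=> /(_ i); rewrite !mxE.
- move=> _ [v /= vS <-].
  have : (v <= D + M)%MS by rewrite (submx_trans vS) // -(addsmx_diff_cap_eq S M) addsmxS ?capmxSr.
  case/sub_addsmxP => -[v1 v2] /= ->.
  have : (v1 *m D <= row_base D)%MS by rewrite eq_row_base submxMl.
  case/submxP=> c ->; exists (c 0); rewrite comb linearD.
  have -> : T (v2 *m M) = 0 by apply/kerT; apply: submxMl.
  by rewrite addr0; congr (T (_ *m _)); apply/rowP => i; rewrite mxE.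
Qed.

End HasDim.

(** A matrix of maximal rank among those with row space in P spans P, since any further vector of P
    could be adjoined. *)
Lemma submod_mx (k : fieldType) n (P : pred 'rV[k]_n) :
    P 0 -> (forall c u v, P u -> P v -> P (c *: u + v)) ->
  exists M : 'M_n, forall v, P v = (v <= M)%MS.
Proof.
move=> P0 Plin.
pose good r := `[< exists2 M : 'M[k]_n, (forall v, (v <= M)%MS -> P v) &
  \rank M = r >].
have ex_good : exists r, good r.
  exists 0%N; apply/asboolP; exists 0; last exact: mxrank0.
  by move=> v; rewrite submx0 => /eqP ->.
have good_le r : good r -> (r <= n)%N.
  by move=> /asboolP[M _ <-]; apply: rank_leq_row.
case: (ex_maxnP ex_good good_le) => r /asboolP[M MP rM] r_max.
exists M => v; apply/idP/idP => [Pv|]; last exact: MP.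
suff : (M + v <= M)%MS by apply: submx_trans; apply: addsmxSr.
rewrite -(eq_leqif (mxrank_leqif_sup (addsmxSl M v))) eqn_leq.
rewrite mxrankS ?addsmxSl // rM r_max //; apply/asboolP.
exists (M + v)%MS => // w /sub_addsmxP[[u1 u2] /= ->].
rewrite [u2]mx11_scalar mul_scalar_mx addrC.
by apply: Plin => //; apply: MP; apply: submxMl.
Qed.

(** * Forms as coefficient vectors and their pairing with functionals *)

Section Forms.
Variables (k : fieldType) (n : nat).
Implicit Types (f g : {mpoly k[n]}) (psi : 'X_{1..n} -> k).

Definition coef d f : 'rV[k]_(nmon n d) := \row_a f@_(mon d a).

Definition form d (v : 'rV[k]_(nmon n d)) : {mpoly k[n]} :=
  \sum_a v 0 a *: 'X_[mon d a].

Lemma coef_is_linear d : linear (coef d).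
Proof. by move=> c f g; apply/rowP => a; rewrite !mxE mcoeffD mcoeffZ. Qed.

HB.instance Definition _ d :=
  GRing.isLinear.Build k {mpoly k[n]} 'rV_(nmon n d) _ (coef d)
    (coef_is_linear d).

Lemma form_is_linear d : linear (@form d).
Proof.
move=> c u v; rewrite /form scaler_sumr -big_split; apply: eq_bigr => a _.
by rewrite !mxE scalerDl scalerA.
Qed.

HB.instance Definition _ d :=
  GRing.isLinear.Build k 'rV_(nmon n d) {mpoly k[n]} _ (@form d)
    (@form_is_linear d).

Lemma form_homog d v : @form d v \is d.-homog.
Proof.
by apply: rpred_sum => a _; apply: dhomogZ; rewrite dhomogX; apply/eqP/mdeg_mon.
Qed.

Lemma formK d : cancel (@form d) (coef d).
Proof.
move=> v; apply/rowP => a; rewrite mxE raddf_sum (bigD1 a) //= big1 ?addr0.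
  by rewrite mcoeffZ mcoeffX eqxx mulr1.
move=> b ne_ba; rewrite mcoeffZ mcoeffX (inj_eq (@mon_inj _ _)).
by rewrite (negPf ne_ba) mulr0.
Qed.

Lemma form_coefX d m :
  form (coef d 'X_[m]) = if mdeg m == d then 'X_[m] else 0.
Proof.
case: eqP => [/monP[a <-]|ne_m].
  rewrite /form (bigD1 a) //= big1 ?addr0 => [|b ne_ba].
    by rewrite mxE mcoeffX eqxx scale1r.
  rewrite mxE mcoeffX eq_sym (inj_eq (@mon_inj _ _)) (negPf ne_ba).
  exact: scale0r.
rewrite /form big1 // => a _; rewrite mxE mcoeffX.
case: eqP => [em|_]; last exact: scale0r.
by case: ne_m; rewrite em mdeg_mon.
Qed.

Lemma form_coef d f : form (coef d f) = pihomog mdeg d f.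
Proof.
rewrite [f]mpolyE !linear_sum; apply: eq_bigr => m _.
by rewrite !linearZ /= form_coefX pihomogX.
Qed.

Lemma coefK d f : f \is d.-homog -> form (coef d f) = f.
Proof. by move=> hf; rewrite form_coef pihomog_dE. Qed.

(* The degree d part of f applied to the functional with values psi on the
   monomials. *)
Definition app d psi f : k := \sum_a f@_(mon d a) * psi (mon d a).

Lemma app_is_linear d psi : linear_for *%R (app d psi).
Proof.
move=> c f g; rewrite /app mulr_sumr -big_split; apply: eq_bigr => a _.
by rewrite mcoeffD mcoeffZ mulrDl mulrA.
Qed.

HB.instance Definition _ d psi :=
  GRing.isLinear.Build k {mpoly k[n]} k *%R (app d psi) (app_is_linear d psi).

Lemma appX d psi m : app d psi 'X_[m] = if mdeg m == d then psi m else 0.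
Proof.
rewrite /app; case: eqP => [/monP[a <-]|ne_m].
  rewrite (bigD1 a) //= big1 ?addr0 => [|b ne_ba].
    by rewrite mcoeffX eqxx mul1r.
  by rewrite mcoeffX eq_sym (inj_eq (@mon_inj _ _)) (negPf ne_ba) mul0r.
rewrite big1 // => a _; rewrite mcoeffX.
case: eqP => [em|_]; last by rewrite mul0r.
by case: ne_m; rewrite em mdeg_mon.
Qed.

Lemma appMX d psi f m : (mdeg m <= d)%N -> app d psi (f * 'X_[m]) =
  \sum_a f@_(mon (d - mdeg m) a) * psi (mon (d - mdeg m) a + m)%MM.
Proof.
move=> le_m; pose psi' m' := psi (m' + m)%MM.
transitivity (app (d - mdeg m) psi' f) => //.
rewrite [f]mpolyE mulr_suml !linear_sum; apply: eq_bigr => m' _.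
rewrite -scalerAl -mpolyXD !linearZ /= !appX mdegD /psi'.
by congr (_ * _); rewrite -[in LHS](subnK le_m) eqn_add2r.
Qed.

Lemma appMX0 d psi f m : (d < mdeg m)%N -> app d psi (f * 'X_[m]) = 0.
Proof.
move=> lt_m; rewrite [f]mpolyE mulr_suml linear_sum big1 //= => m' _.
rewrite -scalerAl -mpolyXD linearZ /= appX mdegD.
by rewrite (_ : (_ == _) = false) ?mulr0 //; apply/eqP; lia.
Qed.

(** Only the part of g of degree complementary to that of f pairs with f. *)
Lemma app_homog0 d i psi f :
    f \is i.-homog -> (forall m, (mdeg m + i)%N = d -> app d psi (f * 'X_[m]) = 0) ->
  forall g, app d psi (f * g) = 0.
Proof.
move=> hf f0 g; rewrite [g]mpolyE mulr_sumr linear_sum big1 //= => m _.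
rewrite -scalerAr linearZ /=.
have [/f0 ->|ne_m] := eqVneq (mdeg m + i)%N d; first by rewrite mulr0.
have [/appMX0 -> |le_m] := ltnP d (mdeg m); first by rewrite mulr0.
rewrite appMX // big1 ?mulr0 // => a _.
rewrite (dhomog_nemf_coeff hf) ?mul0r //; apply/eqP => /= e.
by have := mdeg_mon a; rewrite e; lia.
Qed.

Lemma form_hankel i d psi (v : 'rV_(nmon n i)) : (i <= d)%N ->
  v *m hankel psi i (d - i) = 0 <->
  (forall m, mdeg m = (d - i)%N -> app d psi (form v * 'X_[m]) = 0).
Proof.
move=> le_i.
have appE m : mdeg m = (d - i)%N -> app d psi (form v * 'X_[m]) =
    \sum_a v 0 a * psi (mon i a + m)%MM.
  move=> dm; rewrite appMX ?dm ?leq_subr // subKn //.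
  by apply: eq_bigr => a _; congr (_ * _); rewrite -[v in RHS]formK mxE.
split=> [v0 m dm|v0].
  rewrite appE //; case/monP: dm => b <-.
  by move/rowP: v0 => /(_ b); rewrite !mxE => v0; rewrite -[RHS]v0;
    apply: eq_bigr => a _; rewrite mxE.
apply/rowP => b; rewrite !mxE -[RHS](v0 (mon _ b)) ?mdeg_mon //.
by rewrite appE ?mdeg_mon //; apply: eq_bigr => a _; rewrite mxE.
Qed.

End Forms.

(** * Dimensions of the graded pieces and of the socle *)

Section QuotientDimensions.
Variables (k : fieldType) (n : nat) (I : idealr {mpoly k[n]}).
Local Open Scope classical_set_scope.

Definition quot_form d (v : 'rV[k]_(nmon n d)) : quot_alg I :=
  quot_pi I (form v).

Lemma quot_piZ c f : quot_pi I (c *: f) = c *: quot_pi I f.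
Proof. by rewrite -mul_mpolyC quot_piM. Qed.

Lemma quot_form_is_linear d : linear (@quot_form d).
Proof. by move=> c u v; rewrite /quot_form linearP quot_piD quot_piZ. Qed.

HB.instance Definition _ d :=
  GRing.isLinear.Build k 'rV[k]_(nmon n d) (quot_alg I) _ (@quot_form d)
    (@quot_form_is_linear d).

Lemma ideal_mx_subproof d : exists M : 'M[k]_(nmon n d),
  forall v, (form v \in I) = (v <= M)%MS.
Proof.
apply: submod_mx => [|c u v]; rewrite ?raddf0 ?rpred0 // => uI vI.
by rewrite linearP rpredD //= -mul_mpolyC idealMr.
Qed.

Definition ideal_mx d : 'M[k]_(nmon n d) := sval (cid (ideal_mx_subproof d)).

Lemma ideal_mxP d (v : 'rV[k]_(nmon n d)) :
  (form v \in I) = (v <= ideal_mx d)%MS.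
Proof. exact: (svalP (cid (ideal_mx_subproof d))). Qed.

Lemma quot_form_eq0 d v : @quot_form d v = 0 <-> (v <= ideal_mx d)%MS.
Proof.
rewrite -ideal_mxP -quot_pi_eq0; split=> [/eqP|/eqP]; exact.
Qed.

Lemma quot_pieceE d : quot_piece I d =
  [set quot_form v | v in [set v : 'rV_(nmon n d) | (v <= (1%:M : 'M_(nmon n d)))%MS]].
Proof.
apply/seteqP; split=> _ [x /= hx <-].
  by exists (coef d x) => /=; rewrite ?submx1 // /quot_form coefK.
by exists (form x) => //=; apply: form_homog.
Qed.

Lemma has_dim_piece d :
  has_dim (quot_piece I d) (nmon n d - \rank (ideal_mx d)).
Proof.
rewrite quot_pieceE -[X in (X - _)%N](mxrank1 k (nmon n d)).
by apply: has_dim_image; [apply: submx1 | apply: quot_form_eq0].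
Qed.

(** The variables generate the maximal ideal, since every nonconstant monomial is divisible by one
    of them. *)
Lemma socle_quot_pi f :
  socle I (quot_pi I f) <-> forall l, f * 'X_l \in I.
Proof.
split=> [soc_f l|soc_f _ [g /= g0 <-]].
  rewrite -quot_pi_eq0 quot_piM; apply/eqP/soc_f.
  by exists 'X_l => //=; rewrite mcoeffX mnm1_eq0.
apply/eqP; rewrite -quot_piM quot_pi_eq0 [g]mpolyE mulr_sumr rpred_sum //.
move=> m _; have [-> |ne_m] := eqVneq m 0%MM.
  by rewrite g0 scale0r mulr0 rpred0.
have [|l [m' ->]] := @split_mon _ m; first by rewrite mdeg_eq0.
rewrite mpolyXD -scalerAr -mul_mpolyC idealMr // mulrA mulrC idealMr //.
Qed.

Lemma has_dim_socle_piece d (S : 'M_(nmon n d)) :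
    (forall v, (v <= S)%MS <-> forall l, form v * 'X_l \in I) ->
  has_dim (socle I `&` quot_piece I d) (\rank S - \rank (ideal_mx d)).
Proof.
move=> socS.
have -> : socle I `&` quot_piece I d =
    [set quot_form v | v in [set v : 'rV_(nmon n d) | (v <= S)%MS]].
  rewrite quot_pieceE; apply/seteqP; split=> [_ [/[swap]] [v _ <-]|_ [v vS <-]].
    by move=> /socle_quot_pi/socS vS; exists v.
  split; first by apply/socle_quot_pi/socS.
  by exists v => //=; apply: submx1.
apply: has_dim_image; last exact: quot_form_eq0.
apply/rV_subP => v; rewrite -ideal_mxP => vI; apply/socS => l.
by rewrite mulrC idealMr.
Qed.

End QuotientDimensions.

Section MulMon.
Variables (k : fieldType) (n : nat) (m : 'X_{1..n}) (i j : nat).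

Definition mulmon (v : 'rV[k]_(nmon n i)) : 'rV[k]_(nmon n j) :=
  coef j (form v * 'X_[m]).

Lemma mulmon_is_linear : linear mulmon.
Proof. by move=> c u v; rewrite /mulmon linearP mulrDl -scalerAl linearP. Qed.

HB.instance Definition _ :=
  GRing.isLinear.Build k 'rV[k]_(nmon n i) 'rV[k]_(nmon n j) _ mulmon
    mulmon_is_linear.

End MulMon.

(** * From an algebra to its dual functional *)

Section FromAlgebra.
Variables (k : fieldType) (n : nat) (A : graded_algebra k n).
Local Notation I := (alg_ideal A).
Variables (e p : nat) (s : seq nat).
Hypotheses (lt_pe : (p < e)%N) (size_s : size s = e.+1).
Hypotheses (s_e : nth 0%N s e = 1%N)
  (s_0 : forall i, (i <= e)%N -> i != p -> i != e -> nth 0%N s i = 0%N).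
Hypothesis A_s : socle_vector A s.

Let socdegE : socdeg A = e.
Proof. by have [] := A_s; rewrite size_s => -[]. Qed.

Lemma ideal_high f i : (e < i)%N -> f \is i.-homog -> f \in I.
Proof.
move=> lt_i hf; rewrite -quot_pi_eq0; apply/eqP.
by apply: (@socdeg_last _ _ A i); rewrite ?socdegE //; exists f.
Qed.

Lemma socle_free f i : (i < e)%N -> i != p -> f \is i.-homog ->
  (forall l, f * 'X_l \in I) -> f \in I.
Proof.
move=> lt_i ne_i hf soc_f; rewrite -quot_pi_eq0; apply/eqP.
have [_ /(_ i)] := A_s; rewrite socdegE (s_0 (ltnW lt_i) ne_i) ?(ltn_eqF lt_i) // ltnW //.
move=> /(_ isT)/has_dim0; apply; split; first exact/socle_quot_pi.
by exists f.
Qed.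

Lemma mulX_homog (f : {mpoly k[n]}) i m :
  f \is i.-homog -> f * 'X_[m] \is (i + mdeg m).-homog.
Proof. by move=> hf; apply: dhomogM => //; rewrite dhomogX. Qed.

Lemma mulXU_homog (f : {mpoly k[n]}) i l :
  f \is i.-homog -> f * 'X_l \is i.+1.-homog.
Proof. by move=> hf; rewrite -addn1 -(mdeg1 l) mulX_homog. Qed.

Lemma mulXU (f : {mpoly k[n]}) l m :
  f * 'X_l * 'X_[m] = f * 'X_[U_(l) + m].
Proof. by rewrite -mulrA -mpolyXD. Qed.

(** The degrees i, ..., q - 1 avoid p and e, so there is no socle there, and membership in I
    descends one degree at a time. *)
Lemma socle_free_descent f i q : (q <= e)%N -> (i <= q)%N ->
    (p < i)%N || (q <= p)%N -> f \is i.-homog ->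
    (forall m, mdeg m = (q - i)%N -> f * 'X_[m] \in I) ->
  f \in I.
Proof.
move=> le_q; move ed : (q - i)%N => d.
elim: d i ed f => [|d IHd] i ed f le_i pq hf fI.
  by rewrite -[f]mulr1 -mpolyX0 fI ?mdeg0.
apply: (socle_free _ _ hf) => [||l]; [lia | by case/orP: pq; lia|].
apply: (IHd i.+1) (mulXU_homog l hf) _; [lia | lia | by case/orP: pq; lia|].
by move=> m dm; rewrite mulXU fI // mdegD mdeg1 dm.
Qed.

Let hA i := (nmon n i - \rank (ideal_mx I i))%N.

Lemma ideal_mx_top : nmon n e = (\rank (ideal_mx I e)).+1.
Proof.
have [_ /(_ e)] := A_s; rewrite socdegE s_e leqnn => /(_ isT) soc1.
have e1 : (nmon n e - \rank (ideal_mx I e) = 1)%N.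
  rewrite -[X in (X - _)%N](mxrank1 k (nmon n e)).
  apply: has_dim_inj (has_dim_socle_piece _) soc1 => v; rewrite submx1.
  by split=> // _ l; apply: ideal_high (mulXU_homog _ (form_homog v)).
by have := rank_leq_row (ideal_mx I e); lia.
Qed.

(** Degree e consists of socle only, so the ideal is a hyperplane there; phi is its equation, taken
    from a nonzero column of the cokernel. *)
Lemma top_functional : exists phi : 'X_{1..n} -> k, forall f, f \is e.-homog ->
  (f \in I) = (app e phi f == 0).
Proof.
pose M := ideal_mx I e; have rM := ideal_mx_top.
have /matrix0Pn[i [j nz]] : cokermx M != 0.
  by rewrite -mxrank_eq0 mxrank_coker [X in (X - _)%N]rM subSnn.
pose w := col j (cokermx M).
have Mw : M *m w = 0 by rewrite /w colE mulmxA mulmx_coker mul0mx.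
have rw : \rank w = 1%N.
  apply/eqP; rewrite eqn_leq rank_leq_col lt0n mxrank_eq0.
  apply/eqP => /colP/(_ i); rewrite mxE [RHS]mxE => e0.
  by move: nz; rewrite e0 eqxx.
have kerM : (kermx w <= M)%MS.
  have Mker : (M <= kermx w)%MS by apply/sub_kermxP.
  rewrite -(eq_leqif (mxrank_leqif_sup Mker)) mxrank_ker rw.
  by apply/eqP; rewrite -/M in rM; lia.
pose phi m := \sum_a (mon e a == m)%:R * w a 0.
have phi_mon a : phi (mon e a) = w a 0.
  rewrite /phi (bigD1 a) //= eqxx mul1r big1 ?addr0 // => b ne_ba.
  by rewrite (inj_eq (@mon_inj _ _)) (negPf ne_ba) mul0r.
exists phi => f hf; rewrite -(coefK hf) ideal_mxP.
set v := coef e f.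
have -> : app e phi (form v) = (v *m w) 0 0.
  rewrite mxE; apply: eq_bigr => a _; rewrite phi_mon.
  by congr (_ * _); rewrite -{2}[v]formK mxE.
have -> : (v <= M)%MS = (v <= kermx w)%MS.
  by apply/idP/idP => /submx_trans; apply => //; apply/sub_kermxP.
rewrite sub_kermx; apply/eqP/eqP => [-> |vw]; first by rewrite mxE.
by rewrite [v *m w]mx11_scalar vw raddf0.
Qed.

(** The ideal J of phi contains I in all degrees up to e. They agree above p by descent from degree
    e; in degree p the quotient J/I is the socle, of dimension s_p. Below p, a form of J lies in I
    as soon as its products with all monomials of degree p - i do. *)
Lemma algebra_functional : exists phi : 'X_{1..n} -> k,
  [/\ \rank (hankel phi e 0) = 1%N,
      forall i, (p < i <= e)%N -> hA i = \rank (hankel phi i (e - i)),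
      hA p = (\rank (hankel phi p (e - p)) + nth 0%N s p)%N
    & forall i, (i <= p)%N ->
        (hA i <= nmon n (e - i) + nth 0%N s p * nmon n (p - i))%N].
Proof.
have [phi phiP] := top_functional.
pose J i := kermx (hankel phi i (e - i)).
have JP i (v : 'rV_(nmon n i)) : (i <= e)%N -> (v <= J i)%MS <->
    forall m, mdeg m = (e - i)%N -> form v * 'X_[m] \in I.
  move=> le_i; rewrite /J sub_kermx.
  have hm m : mdeg m = (e - i)%N -> (form v * 'X_[m] \in I) =
      (app e phi (form v * 'X_[m]) == 0).
    move=> dm; apply: phiP; rewrite -(subnKC le_i) -dm.
    exact: mulX_homog (form_homog v).
  split=> [/eqP v0 m dm|vI].
    by rewrite hm //; apply/eqP; move: m dm; apply/form_hankel.
  by apply/eqP/form_hankel => // m dm; apply/eqP; rewrite -hm // vI.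
have MJ i : (i <= e)%N -> (ideal_mx I i <= J i)%MS.
  move=> le_i; apply/rV_subP => v; rewrite -ideal_mxP => vI.
  by apply/JP => // m _; rewrite mulrC idealMr.
have rJ i : \rank (J i) = (nmon n i - \rank (hankel phi i (e - i)))%N.
  exact: mxrank_ker.
have JM i : (p < i <= e)%N -> (J i <= ideal_mx I i)%MS.
  case/andP=> lt_i le_i; apply/rV_subP => v /(JP _ _ le_i) vJ; rewrite -ideal_mxP.
  by apply: (socle_free_descent (q := e) _ le_i _ (form_homog v)); rewrite ?lt_i.
have hAE i : (p < i <= e)%N -> hA i = \rank (hankel phi i (e - i)).
  move=> i_int; rewrite /hA; have -> : \rank (ideal_mx I i) = \rank (J i).
    apply/eqP; rewrite eqn_leq !mxrankS ?JM ?MJ //; lia.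
  by rewrite rJ subKn // rank_leq_row.
have JpP (v : 'rV_(nmon n p)) :
    (v <= J p)%MS <-> forall l, form v * 'X_l \in I.
  split=> [/(JP _ _ (ltnW lt_pe)) vJ l|soc_v].
    apply: (socle_free_descent (q := e) _ lt_pe _ (mulXU_homog l (form_homog v))).
    - by [].
    - by rewrite ltnSn.
    - by move=> m dm; rewrite mulXU vJ // mdegD mdeg1 dm; lia.
  apply/(JP _ _ (ltnW lt_pe)) => m dm.
  have [|l [m' ->]] := @split_mon _ m; first by lia.
  by rewrite mpolyXD mulrA mulrC idealMr.
have s_pE : nth 0%N s p = (\rank (J p) - \rank (ideal_mx I p))%N.
  have [_ /(_ p)] := A_s; rewrite socdegE (ltnW lt_pe) => /(_ isT) soc_p.
  exact: has_dim_inj soc_p (has_dim_socle_piece JpP).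
have MJp := mxrankS (MJ p (ltnW lt_pe)).
exists phi; split=> //.
- have := hAE e; rewrite /hA subnn lt_pe leqnn => <- //.
  by have := ideal_mx_top; lia.
- rewrite /hA; have := rank_leq_row (hankel phi p (e - p)).
  have := rank_leq_row (J p); have := rJ p; lia.
move=> i le_i; have le_ie : (i <= e)%N by lia.
pose sp := nth 0%N s p.
(* W collects the forms of J whose products with the monomials of degree p - i lie in I. Each
   monomial costs at most s_p dimensions, as the products lie in J, where I has codimension s_p in
   degree p. *)
have [W [WJ rW WI]] : exists W : 'M_(nmon n i), [/\ (W <= J i)%MS,
    (\rank (J i) <= \rank W + sp * nmon n (p - i))%N &
    forall v b, (v <= W)%MS -> form v * 'X_[mon (p - i) b] \in I].
  suff : forall ms : seq 'I_(nmon n (p - i)), exists W : 'M_(nmon n i),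
      [/\ (W <= J i)%MS, (\rank (J i) <= \rank W + sp * size ms)%N &
      forall v b, b \in ms -> (v <= W)%MS -> form v * 'X_[mon (p - i) b] \in I].
    case/(_ (enum 'I_(nmon n (p - i)))) => W [WJ]; rewrite size_enum_ord => rW WI.
    by exists W; split=> // v b; apply: WI; rewrite mem_enum.
  elim=> [|b ms [W [WJ rW WI]]]; first by exists (J i); rewrite muln0 addn0.
  pose T := lin1_mx (@mulmon k n (mon (p - i) b) i p).
  have TE v : form (v *m T) = form v * 'X_[mon (p - i) b].
    rewrite mul_rV_lin1 /= coefK // -[X in X.-homog](subnKC le_i).
    by rewrite -[X in (_ + X)%N](mdeg_mon b) mulX_homog ?form_homog.
  pose C := T *m cokermx (ideal_mx I p).
  exists (W :&: kermx C)%MS; split.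
  - exact: submx_trans (capmxSl _ _) WJ.
  - rewrite -[size (b :: ms)]/(size ms).+1 mulnS.
    suff : (\rank (W *m C) <= sp)%N.
      by have := mxrank_mul_ker W C; move: rW; rewrite /sp; lia.
    rewrite /C mulmxA /sp s_pE.
    have WTJ : (W *m T <= J p)%MS.
      apply/rV_subP => _ /submxP[u ->]; rewrite mulmxA.
      apply/(JP _ _ (ltnW lt_pe)) => m dm; rewrite TE -mulrA -mpolyXD.
      move/JP: (submx_trans (submxMl u W) WJ) => /(_ le_ie); apply.
      by rewrite mdegD dm mdeg_mon; lia.
    rewrite (leq_trans (mxrankS (submxMr _ WTJ))) //.
    have := mxrank_mul_ker (J p) (cokermx (ideal_mx I p)).
    suff : (\rank (ideal_mx I p) <=
      \rank (J p :&: kermx (cokermx (ideal_mx I p)))%MS)%N by lia.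
    rewrite mxrankS // sub_capmx (MJ _ (ltnW lt_pe)) /=.
    by apply/sub_kermxP; apply: mulmx_coker.
  - move=> v c; rewrite inE sub_capmx => /predU1P[->|c_in] /andP[vW vC].
      rewrite -TE ideal_mxP submxE -mulmxA -/C.
      by rewrite -sub_kermx.
    exact: WI.
have WM : (W <= ideal_mx I i)%MS.
  apply/rV_subP => v vW; rewrite -ideal_mxP.
  apply: (socle_free_descent (q := p) _ le_i _ (form_homog v)).
  - exact: ltnW.
  - by rewrite leqnn orbT.
  - by move=> m /monP[b <-]; apply: WI.
have rWM := mxrankS WM.
have := rank_leq_col (hankel phi i (e - i)); have := rJ i.
by rewrite /hA -/sp; move: rW rWM; lia.
Qed.

End FromAlgebra.

(** * From an inverse system to an algebra *)

Section InverseSystem.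
Variables (k : fieldType) (n : nat).
Variables (phi : 'X_{1..n} -> k) (psi : nat -> 'X_{1..n} -> k) (e p q : nat).
Implicit Types (f : {mpoly k[n]}) (theta : 'X_{1..n} -> k).

(* The annihilator of the inverse system generated by phi in degree e and by
   psi 0, ..., psi (q - 1) in degree p; see [app] for the pairing. *)
Definition annihilates f : Prop :=
  (forall g, app e phi (f * g) = 0) /\
  (forall j, (j < q)%N -> forall g, app p (psi j) (f * g) = 0).

(** The degree i part of the annihilator. The condition i <= p matters: above degree p the psi j
    impose nothing, while the truncated p - i would create conditions. *)
Definition perp i : 'M[k]_(nmon n i) :=
  (kermx (hankel phi i (e - i)) :&:
   \bigcap_(j < q | (i <= p)%N) kermx (hankel (psi j) i (p - i)))%MS.

Lemma app_form0 i d theta (v : 'rV_(nmon n i)) : (i <= d)%N ->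
  v *m hankel theta i (d - i) = 0 <-> forall g, app d theta (form v * g) = 0.
Proof.
move=> le_i; split=> [/(form_hankel _ _ le_i) v0|v0]; last first.
  by apply/form_hankel.
by apply: app_homog0 (form_homog v) _ => m dm; apply: v0; lia.
Qed.

Lemma app_high0 i d theta f : (d < i)%N -> f \is i.-homog ->
  forall g, app d theta (f * g) = 0.
Proof. by move=> lt_d hf; apply: app_homog0 hf _ => m dm; lia. Qed.

Lemma annihilates_form i (v : 'rV_(nmon n i)) : (i <= e)%N ->
  annihilates (form v) <-> (v <= perp i)%MS.
Proof.
move=> le_i; rewrite /perp sub_capmx sub_kermx; split.
  move=> [/(app_form0 _ _ le_i)/eqP -> psi0] /=.
  apply/sub_bigcapmxP => j le_ip; rewrite sub_kermx; apply/eqP.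
  by apply/app_form0 => //; apply: psi0.
case/andP=> /eqP/(app_form0 _ _ le_i) phi0 /sub_bigcapmxP psi0.
split=> // j lt_j; have [le_ip|lt_p] := leqP i p.
  by apply/app_form0 => //; apply/eqP; rewrite -sub_kermx (psi0 (Ordinal lt_j)).
exact: app_high0 (form_homog v).
Qed.

Lemma app_pihomog d i theta f m : (mdeg m + i)%N = d ->
  app d theta (pihomog mdeg i f * 'X_[m]) = app d theta (f * 'X_[m]).
Proof.
move=> dm; have le_m : (mdeg m <= d)%N by lia.
have coef_pi : coef i (pihomog mdeg i f) = coef i f by rewrite -form_coef formK.
rewrite !appMX //; have -> : (d - mdeg m = i)%N by lia.
by apply: eq_bigr => a _; move/rowP: coef_pi => /(_ a); rewrite !mxE => ->.
Qed.

Lemma annihilates_pihomog f d : annihilates f -> annihilates (pihomog mdeg d f).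
Proof.
case=> phi0 psi0; split=> [|j lt_j]; apply: app_homog0 (pihomogP _ d f) _ => m dm.
  by rewrite app_pihomog.
by rewrite app_pihomog // psi0.
Qed.

Hypothesis phi_top : \rank (hankel phi e 0) = 1%N.

Lemma ann_idealr_closed : idealr_closed [pred f | `[< annihilates f >]].
Proof.
split.
- by apply/asboolP; split=> *; rewrite mul0r raddf0.
- apply/asboolP => -[phi0 _]; suff : hankel phi e 0 = 0.
    by move=> h0; move: phi_top; rewrite h0 mxrank0.
  apply/matrixP => a b; rewrite !mxE (_ : mon 0 b = 0%MM) ?addm0; last first.
    by apply/eqP; rewrite -mdeg_eq0 mdeg_mon.
  by have := phi0 'X_[mon e a]; rewrite mul1r appX mdeg_mon eqxx.
- move=> g f f' /asboolP[phi0 psi0] /asboolP[phi0' psi0']; apply/asboolP.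
  split=> [h|j lt_j h]; rewrite mulrDl [g * f]mulrC -mulrA linearD /=.
    by rewrite phi0 phi0' addr0.
  by rewrite psi0 // psi0' // addr0.
Qed.

Definition ann_ideal : idealr {mpoly k[n]} :=
  HB.pack_for (idealr {mpoly k[n]}) (fun f => `[< annihilates f >])
    (isIdealr.Build _ (fun f : {mpoly k[n]} => `[< annihilates f >])
       ann_idealr_closed).

Lemma ann_idealP f : reflect (annihilates f) (f \in ann_ideal).
Proof. exact: asboolP. Qed.

Lemma rank_ann_ideal i : (i <= e)%N ->
  \rank (ideal_mx ann_ideal i) = \rank (perp i).
Proof.
move=> le_i; have eqv (v : 'rV_(nmon n i)) : (v <= ideal_mx ann_ideal i)%MS = (v <= perp i)%MS.
  rewrite -ideal_mxP; apply/idP/idP => [/ann_idealP/annihilates_form|]; first exact.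
  by move/annihilates_form => v0; apply/ann_idealP/v0.
by apply/eqP; rewrite eqn_leq !mxrankS //; apply/rV_subP => v; rewrite eqv.
Qed.

Hypotheses (lt_pe : (p < e)%N) (perp1 : perp 1 = 0).

Lemma ann_ideal_no_linear f : f \in ann_ideal -> f \is 1.-homog -> f = 0.
Proof.
move=> /ann_idealP f0 hf; rewrite -(coefK hf) in f0 *.
move/annihilates_form: f0 => /(_ (leq_ltn_trans (leq0n p) lt_pe)).
by rewrite perp1 submx0 => /eqP ->; rewrite raddf0.
Qed.

Lemma ann_ideal_top : exists2 a, quot_piece ann_ideal e a & a != 0.
Proof.
have /matrix0Pn[a [b nz]] : hankel phi e 0 != 0.
  by rewrite -mxrank_eq0 phi_top.
exists (quot_pi ann_ideal 'X_[mon e a]).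
  by exists 'X_[mon e a] => //=; rewrite dhomogX; apply/eqP/mdeg_mon.
rewrite quot_pi_eq0; apply: contraNN nz => /ann_idealP[/(_ 'X_[mon 0 b])].
rewrite -mpolyXD appX mdegD !mdeg_mon addn0 eqxx => e0 _.
by rewrite mxE e0.
Qed.

Lemma ann_ideal_last d : (e < d)%N -> forall a, quot_piece ann_ideal d a -> a = 0.
Proof.
move=> lt_e _ [f /= hf <-]; apply/eqP; rewrite quot_pi_eq0; apply/ann_idealP.
by split=> [|j _]; apply: app_high0 hf; lia.
Qed.

Definition ann_algebra : graded_algebra k n :=
  GradedAlgebra
    (fun f fI d => introT (ann_idealP _) (annihilates_pihomog d (elimT (ann_idealP f) fI)))
    ann_ideal_no_linear ann_ideal_top ann_ideal_last.

Lemma ann_h_vector :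
  h_vector ann_algebra (mkseq (fun i => nmon n i - \rank (perp i))%N e.+1).
Proof.
split=> [|i]; first by rewrite size_mkseq.
rewrite -[socdeg _]/e => le_i.
by rewrite nth_mkseq // -(rank_ann_ideal le_i); apply: has_dim_piece.
Qed.

(** In degree p, multiplying by a variable leaves the range of the psi j, so the socle comes from
    all forms killing phi; the rank hypothesis says that the psi j impose q independent conditions
    on these. In the other degrees below e, a form whose multiples by variables annihilate the
    system does so itself. *)
Lemma ann_socle_vector (s : seq nat) : size s = e.+1 ->
    nth 0%N s e = 1%N -> nth 0%N s p = q ->
    (forall i, (i <= e)%N -> i != p -> i != e -> nth 0%N s i = 0%N) ->
    \rank (kermx (hankel phi p (e - p))) = (\rank (perp p) + q)%N ->
  socle_vector ann_algebra s.
Proof.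
move=> size_s s_e s_p s_0 rkp; split=> //= i le_i.
have soc_app d theta (v : 'rV_(nmon n i)) : (i < d)%N ->
    (forall l g, app d theta (form v * 'X_l * g) = 0) ->
    forall g, app d theta (form v * g) = 0.
  move=> lt_i v0; apply: app_homog0 (form_homog v) _ => m dm.
  have [|l [m' ->]] := @split_mon _ m; first by lia.
  by rewrite mpolyXD mulrA.
have [ei|ne_e] := eqVneq i e.
  subst i; rewrite s_e; suff -> : 1%N = (\rank (1%:M : 'M[k]_(nmon n e)) -
      \rank (ideal_mx ann_ideal e))%N.
    apply: has_dim_socle_piece => v; rewrite submx1; split=> // _ l.
    apply/ann_idealP; split=> [|j _];
      by apply: (@app_high0 e.+1); rewrite ?mulXU_homog ?form_homog //; lia.
  rewrite mxrank1 rank_ann_ideal // /perp big_pred0 => [|j]; last by lia.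
  rewrite capmx1 mxrank_ker subKn ?rank_leq_row // subnn.
  exact: esym phi_top.
have lt_i : (i < e)%N by lia.
have [ei|ne_p] := eqVneq i p.
  subst i; rewrite s_p.
  have -> : q = (\rank (kermx (hankel phi p (e - p))) -
      \rank (ideal_mx ann_ideal p))%N.
    by rewrite rank_ann_ideal // rkp addKn.
  apply: has_dim_socle_piece => v; rewrite sub_kermx; split.
    move=> /eqP/(app_form0 _ _ le_i) v0 l; apply/ann_idealP; split=> [g|j _].
      by rewrite -mulrA.
    by apply: app_high0 (mulXU_homog _ (form_homog v)).
  move=> soc_v; apply/eqP/app_form0 => //; apply: soc_app => // l.
  by have /ann_idealP[] := soc_v l.
rewrite s_0 // -(subnn (\rank (ideal_mx ann_ideal i))).
apply: has_dim_socle_piece => v; rewrite -ideal_mxP; split=> [vI l|soc_v].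
  by rewrite mulrC idealMr.
apply/ann_idealP; split=> [|j lt_j].
  by apply: soc_app => // l; have /ann_idealP[] := soc_v l.
have [lt_p|le_p] := ltnP p i; first exact: app_high0 (form_homog v).
apply: soc_app => [|l]; first by lia.
by have /ann_idealP[_ /(_ j lt_j)] := soc_v l.
Qed.

End InverseSystem.

(** * General functionals of degree p *)

Section GeneralInverseSystem.
Variables (k : fieldType) (char_k : [pchar k] =i pred0).

Lemma nmon3S d : nmon 3 d.+1 = (nmon 3 d + d.+2)%N.
Proof.
have nmonE' i : nmon 3 i = 'C(i + 2, 2).
  by rewrite nmonE -[RHS]bin_sub ?leq_addl // addnK.
by rewrite !nmonE' !addn2 binS bin1 addnC.
Qed.

Lemma nmon30 : nmon 3 0 = 1%N.
Proof. by rewrite nmonE bin0. Qed.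

Lemma leq_nmon i j : (i <= j)%N -> (nmon 3 i <= nmon 3 j)%N.
Proof.
elim: j => [|j IHj]; first by rewrite leqn0 => /eqP ->.
rewrite leq_eqVlt ltnS => /predU1P[-> //|/IHj le_i].
by rewrite nmon3S; lia.
Qed.

(** Each new general functional of degree p imposes N(p - i) independent conditions in degree i, or
    as many as there is room for. *)
Lemma exists_general_perp (phi : 'X_{1..3} -> k) e p q :
  exists psi, forall i, (i <= p)%N -> \rank (perp phi psi e p q i) =
    (nmon 3 i - \rank (hankel phi i (e - i)) - q * nmon 3 (p - i))%N.
Proof.
elim: q => [|q [psi psiP]].
  exists (fun=> phi) => i le_i.
  by rewrite /perp big_ord0 capmx1 mxrank_ker subn0.
(* N(p) points, general with respect to the current [perp], suffice to make all ranks maximal; the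
   exponent p + 1 makes the restriction to the curve injective up to degree p. *)
have [theta thetaP] := exists_add_points char_k p.+1 (nmon 3 p) (fun=> 0) p
  (perp phi psi e p q).
exists (fun j => if (j < q)%N then psi j else theta) => i le_i.
set psi' := fun j => _.
have -> : perp phi psi' e p q.+1 i =
    (perp phi psi e p q i :&: kermx (hankel theta i (p - i)))%MS.
  rewrite /perp le_i big_ord_recr /= {2}/psi' ltnn capmxA.
  by congr (_ :&: _ :&: _)%MS; apply: eq_bigr => j _; rewrite /psi' ltn_ord.
have [ge_r _] := thetaP i le_i.
have := mxrank_mul_ker (perp phi psi e p q i) (hankel theta i (p - i)).
have free_Q : row_free (expmx k p.+1 i).
  by rewrite -row_leq_rank rank_expmx_inj //; lia.
move: ge_r; rewrite (mxrankMfree _ free_Q) psiP //.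
rewrite rank_expmx_inj; last by lia.
have := rank_leq_col (perp phi psi e p q i *m hankel theta i (p - i)).
have := leq_nmon le_i.
by rewrite mulSn; move: (q * _)%N; lia.
Qed.

End GeneralInverseSystem.

(** * Extremal Hilbert functions *)

Section ConcaveHilbert.
Variables (e : nat) (H : nat -> nat).
Local Notation N := (nmon 3).
Local Open Scope nat_scope.

(* In [gh_concave], t is the degree of a nonzero form of the ideal. *)
Record gorenstein_hilb : Prop := GorensteinHilb {
  gh_le : forall i, H i <= N i;
  gh_sym : forall i, i <= e -> H (e - i) = H i;
  gh_concave : forall t i, t <= e -> H t < N t -> i.+2 <= e -> t <= i.+2 ->
    t <= e - i -> H i.+2 + H i <= (H i.+1).*2;
  gh0 : H 0 = 1 }.

Hypothesis HH : gorenstein_hilb.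

(** Where concavity applies, the increments of H do not grow. *)
Lemma gh_increment t d i j : t <= e -> H t < N t -> t <= i.+2 ->
  H i.+1 <= H i + d -> i <= j -> j.+1 <= e.+1 - t -> H j.+1 <= H j + d.
Proof.
move=> le_t lt_t le_ti inc_i; elim: j => [|j IHj]; first by case: i le_ti inc_i.
rewrite leq_eqVlt => /predU1P[<- //|]; rewrite ltnS => le_ij le_j.
have t_gt0 : 0 < t by case: (t) lt_t => //; rewrite (gh0 HH) nmon30.
have := gh_concave HH le_t lt_t (i := j); have := IHj le_ij; lia.
Qed.

Lemma gh_unimodal_step j : (j.*2).+1 <= e -> H j <= H j.+1.
Proof.
move=> le_j; rewrite leqNgt; apply/negP => lt_j.
have lt_N : H j.+1 < N j.+1.
  by have := gh_le HH j; have := leq_nmon (leqnSn j); lia.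
have decr d : H (j.+1 + d) <= H j.+1 \/ e - j < j.+1 + d.
  elim: d => [|d [IHd|IHd]]; [by left; rewrite addn0 | | by right; lia].
  have [le_d|lt_d] := leqP (j.+1 + d.+1) (e - j); last by right.
  left; have := @gh_increment j.+1 0 j (j.+1 + d); rewrite -addnS => inc.
  by have := inc _ lt_N; lia.
have := gh_sym HH (i := j); have := decr (e - j - j.+1).
by rewrite subnKC; lia.
Qed.

Lemma gh_unimodal i j : i <= j -> j.*2 <= e.+1 -> H i <= H j.
Proof.
elim: j => [|j IHj]; first by rewrite leqn0 => /eqP ->.
rewrite leq_eqVlt ltnS => /predU1P[-> //|le_i] le_j.
by have := IHj le_i; have := gh_unimodal_step (j := j); lia.
Qed.

(** Reflected to e - i <= e - p, both degrees lie in the increasing half. *)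
Lemma gh_le_of_ge_half p i : e <= p.*2.+1 -> p <= i <= e -> H i <= H p.
Proof.
move=> le_e /andP[le_p le_i]; have le_pe : p <= e by lia.
by rewrite -(gh_sym HH le_i) -(gh_sym HH le_pe) gh_unimodal //; lia.
Qed.

Lemma gh_linear p d i j : H p < N p -> p.*2 <= e -> i < p -> H i.+1 < N i.+1 ->
  H i.+1 <= H i + d -> p <= j -> j <= e - i -> H j <= H p + (j - p) * d.
Proof.
move=> lt_p le_p lt_i lt_N inc; elim: j => [|j IHj] le_j le_je.
  by move: le_j; rewrite leqn0 => /eqP ->; apply: leq_addr.
move: le_j; rewrite leq_eqVlt => /predU1P[<-|le_j]; first by rewrite subnn addn0.
rewrite subSn // mulSn; have := IHj le_j (ltnW le_je).
have := @gh_increment i.+1 d i j; move: (_ * d); lia.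
Qed.

(** H starts at 1 and is at most p in degree p, so some step before p does not increase; concavity
    then forbids growth up to the reflected degree, and symmetry covers the rest. *)
Lemma gh_small p i : p.*2 <= e -> H p <= p -> p <= i <= e -> H i <= H p.
Proof.
move=> le_p small /andP[le_pi le_i].
have [i0 lt_i0 dec] : exists2 i0, i0 < p & H i0.+1 <= H i0.
  have [/existsP[i0 h]|/existsPn no] := boolP [exists i0 : 'I_p, H i0.+1 <= H i0].
    by exists i0.
  have grow j : j <= p -> j < H j.
    elim: j => [|j IHj] lt_j; first by rewrite gh0.
    by have := no (Ordinal lt_j); have := IHj (ltnW lt_j); rewrite /=; lia.
  by have := grow p (leqnn p); lia.
have lt_N : H i0.+1 < N i0.+1.
  by have := gh_le HH i0; have := nmon3S i0; lia.
have lt_Np : H p < N p.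
  apply: (leq_ltn_trans small); elim: (p) => [|j IHj]; first by rewrite nmon30.
  by rewrite nmon3S; lia.
have lin j : p <= j -> j <= e - i0 -> H j <= H p.
  move=> le_pj le_je; have := @gh_linear p 0 i0 j; rewrite muln0 !addn0.
  by apply.
have [le_ie|lt_ie] := leqP i (e - i0); first exact: lin.
rewrite -(gh_sym HH le_i); apply: (@leq_trans (H i0)).
  by apply: gh_unimodal; lia.
by rewrite -(gh_sym HH (i := i0)) ?lin //; lia.
Qed.

Lemma gh_le_linear p q i : 0 < q <= 2 -> q <= p -> H p + q <= N p ->
  p.*2 <= e -> p <= i <= e - p -> H i + q <= N p + (i - p) * (p.+1 - q).
Proof.
move=> q_int le_qp le_N le_p /andP[le_pi le_i].
have ex_t : exists t, H t < N t by exists p; lia.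
case: (ex_minnP ex_t) => -[|t]; first by rewrite (gh0 HH) nmon30.
move=> lt_t min_t; have le_tp : t.+1 <= p by apply: min_t; lia.
have Ht : H t = N t.
  apply/eqP; rewrite eqn_leq (gh_le HH) leqNgt; apply/negP => /min_t.
  by rewrite ltnn.
(* The least degree of a form in the ideal is t + 1. The step to it is at most t + 1 <= p - 1 if t +
   1 < p, which is where q <= 2 enters, and at most p + 1 - q if t + 1 = p. *)
suff : H t.+1 <= H t + (p.+1 - q).
  by have := @gh_linear p (p.+1 - q) t i; lia.
move: le_tp; rewrite leq_eqVlt => /predU1P[etp|lt_tp].
  by subst p; have := nmon3S t; lia.
by have := nmon3S t; lia.
Qed.

End ConcaveHilbert.

Lemma gor_gorenstein_hilb (k : fieldType) (char_k : [pchar k] =i pred0)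
    (phi : 'X_{1..3} -> k) e :
  \rank (hankel phi e 0) = 1%N -> gorenstein_hilb e (gor_hilb phi e).
Proof.
move=> top; split.
- exact: gor_hilb_le.
- exact: gor_hilb_sym.
- exact: gor_hilb_concave.
- by rewrite -(gor_hilb_sym phi (leq0n e)) subn0 /gor_hilb subnn.
Qed.

(** * Arithmetic of the Hilbert function of a plane curve *)

Section CurveHilb.
Local Open Scope nat_scope.

Lemma curve_hilb0 d : curve_hilb 0 d = 0.
Proof. by rewrite /curve_hilb big1 // => l _; rewrite minn0. Qed.

Lemma curve_hilb_d0 r : curve_hilb r 0 = minn 1 r.
Proof. by rewrite /curve_hilb big_ord1. Qed.

Lemma curve_hilb_small r d : d < r -> curve_hilb r d = nmon 3 d.
Proof.
elim: d => [|d IHd] lt_d; first by rewrite curve_hilb_d0 nmon30; lia.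
by rewrite curve_hilbS IHd ?nmon3S; lia.
Qed.

(** N(j) counts the forms of degree r + j divisible by the equation of the curve. *)
Lemma curve_hilb_compl r j : curve_hilb r (r + j) + nmon 3 j = nmon 3 (r + j).
Proof.
elim: j => [|j IHj].
  case: r => [|r]; first by rewrite curve_hilb0.
  by rewrite addn0 curve_hilbS nmon3S nmon30 curve_hilb_small //; lia.
by rewrite addnS curve_hilbS !nmon3S; lia.
Qed.

Lemma curve_hilb_linear r d j : r <= d.+2 ->
  curve_hilb r (d + j) = curve_hilb r d + j * r.
Proof.
move=> le_r; elim: j => [|j IHj]; first by rewrite !addn0.
by rewrite addnS curve_hilbS IHj mulSn; lia.
Qed.

Lemma leq_curve_hilb r i j : i <= j -> curve_hilb r i <= curve_hilb r j.
Proof.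
move=> /subnKC <-; elim: (j - i) => [|l IHl]; first by rewrite addn0.
by rewrite addnS curve_hilbS; lia.
Qed.

Lemma curve_hilb_le r d : curve_hilb r d <= nmon 3 d.
Proof.
elim: d => [|d IHd]; first by rewrite curve_hilb_d0 nmon30; lia.
by rewrite curve_hilbS nmon3S; lia.
Qed.

End CurveHilb.

(* The dual functional is a sum of evaluations at general points of a curve of
   degree r, plus c general points of the plane. *)
Lemma exists_gor_hilb (k : fieldType) (char_k : [pchar k] =i pred0) e r c :
  exists phi : 'X_{1..3} -> k, forall i, (i <= e)%N ->
  (minn (minn (nmon 3 i) (nmon 3 (e - i)))
     (minn (curve_hilb r i) (curve_hilb r (e - i)) + c) <=
   gor_hilb phi e i <= curve_hilb r i + c)%N.
Proof.
have [phi1 phi1P] : exists phi1 : 'X_{1..3} -> k, forall i, (i <= e)%N ->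
    (minn (curve_hilb r i) (curve_hilb r (e - i)) <=
     gor_hilb phi1 e i <= curve_hilb r i)%N.
  have [->|r_gt0] := posnP r.
    exists (fun=> 0) => i _; rewrite !curve_hilb0 min0n /gor_hilb.
    have -> : @hankel k 3 (fun=> 0) i (e - i) = 0.
      by apply/matrixP => a b; rewrite !mxE.
    by rewrite mxrank0.
  (* N(e) points on the curve are enough to reach every rank that the curve allows. *)
  have [phi1 phi1P] := exists_add_points char_k r (nmon 3 e) (fun=> 0) e
    (fun i => 1%:M).
  exists phi1 => i le_i; have [] := phi1P i le_i; rewrite !mul1mx.
  have -> : @hankel k 3 (fun=> 0) i (e - i) = 0.
    by apply/matrixP => a b; rewrite !mxE.
  rewrite mxrank0 !rank_expmx // /gor_hilb.
  have := curve_hilb_le r i; have := leq_nmon le_i; lia.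
have [phi phiP] := exists_add_points char_k e.+1 c phi1 e (fun i => 1%:M).
exists phi => i le_i; have [] := phiP i le_i; rewrite !mul1mx.
rewrite !rank_expmx_inj; [|lia..].
by have := phi1P i le_i; rewrite /gor_hilb; lia.
Qed.

Lemma all2_leqP (h h' : seq nat) : all2 leq h' h <->
  size h' = size h /\ forall i, (i < size h)%N -> (nth 0%N h' i <= nth 0%N h i)%N.
Proof.
elim: h h' => [|x h IHh] [|x' h'] /=; split=> //; try by case.
  case/andP=> le_x /IHh[-> le_h]; split=> // -[|i]; [by [] | exact: le_h].
case=> -[eq_size] le_h; apply/andP; split; first exact: (le_h 0%N).
by apply/IHh; split=> // i lt_i; apply: (le_h i.+1).
Qed.

Lemma rank_hankel_gt0 (k : fieldType) n (phi : 'X_{1..n} -> k) e i :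
  (i <= e)%N -> \rank (hankel phi e 0) = 1%N ->
  (0 < \rank (hankel phi i (e - i)))%N.
Proof.
move=> le_i top; rewrite lt0n mxrank_eq0; apply/eqP => phi0.
suff : hankel phi e 0 = 0 by move=> h0; move: top; rewrite h0 mxrank0.
have split_at : forall j m, (j <= mdeg m)%N ->
    exists m1 m2 : 'X_{1..n}, m = (m1 + m2)%MM /\ mdeg m1 = j.
  elim=> [|j IHj] m le_j; first by exists 0%MM, m; rewrite add0m mdeg0.
  have [m1 [m2 [em dm1]]] := IHj m (ltnW le_j).
  have [|l [m' em2]] := @split_mon _ m2; first by move: le_j; rewrite em mdegD; lia.
  exists (m1 + U_(l))%MM, m'; rewrite em em2 addmA; split=> //.
  by rewrite mdegD mdeg1; lia.
apply/matrixP => a b; rewrite !mxE; set m := (_ + _)%MM.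
have dm : mdeg m = e by rewrite mdegD !mdeg_mon addn0.
have [|m1 [m2 [em dm1]]] := split_at i m; first by rewrite dm.
have dm2 : mdeg m2 = (e - i)%N by move: dm; rewrite em mdegD; lia.
rewrite em; have [c <-] := monP dm1; have [d <-] := monP dm2.
by have /matrixP/(_ c d) := phi0; rewrite !mxE.
Qed.

Lemma leq_nmon_vars m p : (0 < p)%N -> (m <= 3)%N -> (nmon m p <= nmon 3 p)%N.
Proof.
move=> p_gt0; case: m => [_|m le_m].
  case: (posnP (nmon 0 p)) => [-> //|nmon_gt0].
  have := mdeg_mon (Ordinal nmon_gt0); rewrite mdegE big_ord0; lia.
rewrite !nmonE; have -> : 'C(p + 2, p) = 'C((p + m) + (2 - m), p) by congr 'C(_, _); lia.
elim: (2 - m)%N => [|d IHd]; first by rewrite addn0.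
by rewrite addnS (leq_trans IHd) // leq_bin2l.
Qed.

(** * Admissible h-vectors and their maxima *)

Section SocleType.
Variables (k : fieldType) (char_k : [pchar k] =i pred0).
Variables (e p : nat) (s : seq nat).
Hypotheses (p_gt0 : (0 < p)%N) (lt_pe : (p < e)%N) (size_s : size s = e.+1).
Hypotheses (s_e : nth 0%N s e = 1%N) (s_p : (0 < nth 0%N s p)%N)
  (s_0 : forall i, (i <= e)%N -> i != p -> i != e -> nth 0%N s i = 0%N).
Local Notation q := (nth 0%N s p).
Local Notation N := (nmon 3).

(** The consequence of the bound on the minimal embedding dimension: phi contributes at least 1 in
    degree p, so s_p stays below N(p). *)
Lemma socle_vector_lt m (A : graded_algebra k m) : (m <= 3)%N ->
  socle_vector A s -> (q < N p)%N.
Proof.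
move=> le_m A_s.
have [phi [top _ hp _]] := algebra_functional lt_pe size_s s_e s_0 A_s.
have := rank_hankel_gt0 (ltnW lt_pe) top; have := leq_nmon_vars p_gt0 le_m.
by move: hp; lia.
Qed.

Lemma admissible_hilb h : admissible k 3 s h -> size h = e.+1 /\
  exists H, [/\ gorenstein_hilb e H,
    forall i, (p < i <= e)%N -> nth 0%N h i = H i,
    nth 0%N h p = (H p + q)%N,
    forall i, (i <= e)%N -> (nth 0%N h i <= N i)%N &
    forall i, (i <= p)%N -> (nth 0%N h i <= N (e - i) + q * N (p - i))%N].
Proof.
move=> [A [A_s [size_h A_h]]].
have [phi [top h_high h_p h_low]] := algebra_functional lt_pe size_s s_e s_0 A_s.
have socE : socdeg A = e by have [] := A_s; rewrite size_s => -[].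
split; first by rewrite size_h socE.
have hE i : (i <= e)%N ->
    nth 0%N h i = (N i - \rank (ideal_mx (alg_ideal A) i))%N.
  by move=> le_i; apply: has_dim_inj (A_h i _) (has_dim_piece _ i); rewrite socE.
exists (gor_hilb phi e); split.
- exact: gor_gorenstein_hilb.
- by move=> i i_int; rewrite hE ?h_high //; lia.
- by rewrite hE ?h_p // ltnW.
- by move=> i le_i; rewrite hE // leq_subr.
- by move=> i le_i; rewrite hE ?h_low //; lia.
Qed.

(** The algebra is defined by phi together with q general functionals of degree p. For p = 1 the
    condition of equality keeps linear forms out of the ideal. *)
Lemma gor_admissible (phi : 'X_{1..3} -> k) :
    \rank (hankel phi e 0) = 1%N -> (gor_hilb phi e p + q <= N p)%N ->
    (p = 1%N -> (gor_hilb phi e p + q)%N = N p) ->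
  exists h, [/\ admissible k 3 s h, size h = e.+1,
    forall i, (p < i <= e)%N -> nth 0%N h i = gor_hilb phi e i,
    forall i, (i <= p)%N ->
      nth 0%N h i = minn (N i) (gor_hilb phi e i + q * N (p - i)) &
    (gor_hilb phi e p + q)%N = N p ->
      forall i, (i <= p)%N -> nth 0%N h i = N i].
Proof.
move=> top le_q p1.
have [psi psiP] := exists_general_perp char_k phi e p q.
have rank_perp_p : \rank (perp phi psi e p q p) = (N p - gor_hilb phi e p - q)%N.
  by rewrite psiP // subnn nmon30 muln1.
(* The ideal is zero in degree p, hence in every degree i <= p: multiplying by a monomial of degree
   p - i is injective. *)
have perp0 : (gor_hilb phi e p + q)%N = N p ->
    forall i, (i <= p)%N -> perp phi psi e p q i = 0.
  move=> full i le_i; apply/eqP/rowV0P => v.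
  have le_ie : (i <= e)%N by lia.
  move/(annihilates_form _ _ _ _ _ le_ie) => [phi0 psi0].
  have [|a _] := @monP 3 (p - i) (U_(0%R) *+ (p - i))%MM.
    by rewrite mdegMn mdeg1 mul1n.
  set x := mon (p - i) a; have hf : form v * 'X_[x] \is p.-homog.
    by rewrite -(subnKC le_i) -(mdeg_mon a) mulX_homog ?form_homog.
  have : (coef p (form v * 'X_[x]) <= perp phi psi e p q p)%MS.
    apply/annihilates_form; first exact: ltnW.
    by rewrite coefK //; split=> [g|j lt_j g]; rewrite -mulrA ?phi0 ?psi0.
  have -> : perp phi psi e p q p = 0.
    by apply/eqP; rewrite -mxrank_eq0 rank_perp_p; lia.
  rewrite submx0 => /eqP c0; have : form v * 'X_[x] = 0.
    by rewrite -(coefK hf) c0 raddf0.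
  have X_neq0 : 'X_[x] != 0 :> {mpoly k[3]}.
    apply: contra_eq_neq (mcoeffX k x x) => ->.
    by rewrite mcoeff0 eqxx eq_sym oner_eq0.
  move/eqP; rewrite mulf_eq0 (negPf X_neq0) orbF => /eqP v0.
  by rewrite -[v]formK v0 raddf0.
(* For p > 1 a single functional of degree p already imposes N(p - 1) >= 3 conditions on linear
   forms. *)
have perp1 : perp phi psi e p q 1 = 0.
  have [p_gt1|] := ltnP 1 p; last by move=> le_p; apply: perp0; lia.
  apply/eqP; rewrite -mxrank_eq0 psiP // subn_eq0.
  have := leq_nmon (i := 1) (j := p - 1); have := nmon3S 0; rewrite nmon30.
  by move=> N1 le_N; have := leq_mul s_p (le_N _); nia.
exists (mkseq (fun i => N i - \rank (perp phi psi e p q i))%N e.+1); split.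
- exists (ann_algebra top lt_pe perp1); split; last exact: ann_h_vector.
  apply: ann_socle_vector => //; rewrite mxrank_ker rank_perp_p -/(gor_hilb _ _ _).
  by move: le_q; lia.
- by rewrite size_mkseq.
- move=> i i_int; rewrite nth_mkseq; last by lia.
  rewrite /perp big_pred0 => [|j]; last by lia.
  by rewrite capmx1 mxrank_ker subKn // rank_leq_row.
- move=> i le_i; rewrite nth_mkseq ?psiP // -/(gor_hilb _ _ _); last by lia.
  by have := gor_hilb_le phi e i; lia.
- move=> full i le_i; rewrite nth_mkseq ?perp0 ?mxrank0 ?subn0 //; lia.
Qed.

(** The second alternative bounds H p by N(e - p), whatever the number of points. *)
Lemma exists_gor_admissible r c : (0 < r + c)%N ->
    (curve_hilb r p + c + q <= N p \/ nmon 3 (e - p) + q <= N p)%N ->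
    (p = 1%N -> (curve_hilb r p + c + q)%N = N p) ->
  exists h H, [/\ admissible k 3 s h /\ size h = e.+1,
    forall i, (p < i <= e)%N -> nth 0%N h i = H i,
    forall i, (i <= p)%N -> nth 0%N h i = minn (N i) (H i + q * N (p - i)),
    (H p + q)%N = N p -> forall i, (i <= p)%N -> nth 0%N h i = N i &
    forall i, (i <= e)%N ->
      (minn (minn (N i) (N (e - i)))
        (minn (curve_hilb r i) (curve_hilb r (e - i)) + c) <= H i <=
       minn (minn (N i) (N (e - i))) (curve_hilb r i + c))%N].
Proof.
move=> rc_gt0 fits p1.
have [phi phiP] := exists_gor_hilb char_k e r c.
have H_le i : (gor_hilb phi e i <= N (e - i))%N by apply: rank_leq_col.
have H_leN i : (gor_hilb phi e i <= N i)%N by apply: gor_hilb_le.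
have top : \rank (hankel phi e 0) = 1%N.
  have := phiP e (leqnn e); have := H_le e; rewrite /gor_hilb subnn.
  have := leq_nmon (leq0n e); have := leq_curve_hilb r (leq0n e).
  by have := nmon30; rewrite curve_hilb_d0; lia.
have le_p := phiP p (ltnW lt_pe).
have [||h [h_adm size_h h_high h_low h_full]] := gor_admissible top.
- by case: fits; have := H_le p; lia.
- move=> ep; have full := p1 ep; have le_pep : (p <= e - p)%N by lia.
  have := leq_curve_hilb r le_pep; have := leq_nmon le_pep; lia.
exists h, (gor_hilb phi e); split=> // i le_i.
by have := phiP i le_i; have := H_le i; have := H_leN i; lia.
Qed.

Local Open Scope nat_scope.

Lemma max_admissibleP h : admissible k 3 s h -> size h = e.+1 ->
    (forall h' H', gorenstein_hilb e H' ->
      (forall i, p < i <= e -> nth 0 h' i = H' i) ->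
      nth 0 h' p = H' p + q ->
      (forall i, i <= e -> nth 0 h' i <= N i) ->
      (forall i, i <= p -> nth 0 h' i <= N (e - i) + q * N (p - i)) ->
      forall i, i <= e -> nth 0 h' i <= nth 0 h i) ->
  max_admissible k 3 s h.
Proof.
move=> h_adm size_h h_max; split=> // h' /admissible_hilb[size_h' [H' [HH high at_p le_N low]]].
apply/all2_leqP; rewrite size_h size_h'; split=> // i; rewrite ltnS.
exact: h_max HH high at_p le_N low i.
Qed.

Lemma gh_le_sym H i : gorenstein_hilb e H -> i <= e -> H i <= N (e - i).
Proof. by move=> HH le_i; rewrite -(gh_sym HH le_i) (gh_le HH). Qed.

(** With N(e) general points all catalecticants have maximal rank, and every entry of h meets the
    general upper bound. *)
Lemma max_admissible_compressed : N (e - p) + q <= N p ->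
  exists h, max_admissible k 3 s h.
Proof.
move=> fits; have N0 := nmon30; have Ne := leq_nmon (leq0n e).
have [|||h [H [[h_adm size_h] h_high h_low _ HE]]] := exists_gor_admissible (r := 0) (c := N e).
- lia.
- by right.
- by move=> ep; have := @leq_nmon 1 (e - p); have := s_p; rewrite ep in fits *; lia.
have {}HE i : i <= e -> H i = minn (N i) (N (e - i)).
  move=> le_i; have := HE i le_i; rewrite !curve_hilb0.
  by have := leq_nmon le_i; lia.
exists h; apply: max_admissibleP => // h' H' HH high _ le_N low i le_i.
have [le_ip|lt_pi] := leqP i p.
  rewrite h_low // HE //; have := le_N i le_i; have := low i le_ip.
  by move: (q * _); lia.
rewrite h_high ?HE ?lt_pi // leq_min le_N //= high ?lt_pi //.
exact: gh_le_sym.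
Qed.

(** N(p) - q general points give H i = N(p) - q wherever the sizes of the catalecticants allow it;
    by [bound], nothing does better above p. Degree p is full, hence so are all lower degrees. *)
Lemma max_admissible_points : q < N p -> N p <= N (e - p) + q ->
    (forall H, gorenstein_hilb e H -> H p + q <= N p ->
      forall i, p <= i <= e -> H i + q <= N p) ->
  exists h, max_admissible k 3 s h.
Proof.
move=> lt_q fits bound.
have [|||h [H [[h_adm size_h] h_high _ h_full HE]]] :=
  exists_gor_admissible (r := 0) (c := N p - q); rewrite ?curve_hilb0.
- lia.
- by left; lia.
- lia.
have Hp : H p + q = N p.
  by have := HE p (ltnW lt_pe); rewrite !curve_hilb0; lia.
exists h; apply: max_admissibleP => // h' H' HH high at_p le_N _ i le_i.
have [le_ip|lt_pi] := leqP i p; first by rewrite h_full // le_N.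
rewrite h_high ?lt_pi //; have := HE i le_i; rewrite !curve_hilb0.
have := leq_nmon (ltnW lt_pi); have := le_N p (ltnW lt_pe).
have := bound H' HH _ i; rewrite at_p high ?lt_pi //.
have := gh_le_sym HH le_i; lia.
Qed.

(** A general sum over a curve of degree p, for q = 1, or over a curve of degree p - 1 and one more
    point, for q = 2, attains the linear bound of [gh_le_linear]. *)
Lemma max_admissible_curve : q <= 2 -> q <= p -> p.*2.+2 <= e ->
  exists h, max_admissible k 3 s h.
Proof.
move=> le_q2 le_qp le_pe; pose r := p.+1 - q.
have small j : j < p -> N j <= curve_hilb r j + q.-1.
  move=> lt_j; have [lt_r|le_r] := ltnP j r.
    by rewrite curve_hilb_small // leq_addr.
  have ej : r + 0 = j by move: le_r; rewrite /r; lia.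
  by have := curve_hilb_compl r 0; rewrite ej nmon30; move: le_r; rewrite /r; lia.
have HCp : curve_hilb r p + q.-1 + q = N p.
  have [q1|q2] : q = 1 \/ q = 2 by lia.
    have ep : r + 0 = p by rewrite /r; lia.
    by have := curve_hilb_compl r 0; rewrite ep nmon30; lia.
  have ep : r + 1 = p by rewrite /r; lia.
  by have := curve_hilb_compl r 1; rewrite ep nmon3S nmon30; lia.
have lin j : p <= j -> curve_hilb r j = curve_hilb r p + (j - p) * r.
  by move=> le_j; rewrite -curve_hilb_linear ?subnKC //; lia.
have [|||h [H [[h_adm size_h] h_high _ h_full HE]]] :=
  exists_gor_admissible (r := r) (c := q.-1).
- by rewrite /r; lia.
- by left; lia.
- by [].
have le_pep : p <= e - p by lia.
have Hp : H p + q = N p.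
  have := HE p (ltnW lt_pe); have := leq_nmon le_pep.
  by have := leq_curve_hilb r le_pep; lia.
exists h; apply: max_admissibleP => // h' H' HH high at_p le_N _ i le_i.
have [le_ip|lt_pi] := leqP i p; first by rewrite h_full // le_N.
rewrite h_high ?high ?lt_pi //.
(* By symmetry the comparison may be made in the smaller of the degrees i and e - i. *)
have [j [ej le_ji le_je]] : exists j, [/\ H' j = H' i, j <= i & j <= e - i].
  have [le_ie|lt_ei] := leqP i (e - i); first by exists i.
  by exists (e - i); rewrite (gh_sym HH) //; split=> //; lia.
have le_j : H' j <= curve_hilb r j + q.-1.
  have [lt_jp|le_pj] := ltnP j p; first exact: leq_trans (gh_le HH j) (small j lt_jp).
  have := @gh_le_linear e H' HH p q j; rewrite -/r lin // -at_p.
  have := le_N p (ltnW lt_pe); rewrite at_p; move: (_ * r); lia.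
have := HE i le_i; have := leq_nmon le_ji; have := leq_nmon le_je.
have := leq_curve_hilb r le_ji; have := leq_curve_hilb r le_je.
have := gh_le HH j; lia.
Qed.

Lemma no_max_admissible : 3 <= q -> q + p < N p -> p.*2.+2 <= e ->
  ~ exists h, max_admissible k 3 s h.
Proof.
move=> q_ge3 lt_q le_pe [h [h_adm h_max]].
have p_gt1 : 1 < p.
  rewrite ltnNge; apply/negP => /leq_nmon le_N1.
  by have := nmon3S 0; rewrite nmon30; lia.
have le_pep : p.+1 <= e - p by lia.
have {}h_max h' : admissible k 3 s h' -> forall i, i <= e -> nth 0 h' i <= nth 0 h i.
  move=> /h_max/all2_leqP[_ le_h] i le_i; apply: le_h.
  by have [-> _] := admissible_hilb h_adm.
have [size_h [H [HH high at_p le_N _]]] := admissible_hilb h_adm.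
have N_pep := leq_nmon le_pep; have N_S := nmon3S p.
have [|||h1 [H1 [[adm1 _] high1 _ full1 H1E]]] :=
  exists_gor_admissible (r := 0) (c := N p - q); rewrite ?curve_hilb0; try lia.
have H1p : H1 p + q = N p.
  by have := H1E p (ltnW lt_pe); rewrite !curve_hilb0; lia.
have Hp : H p + q = N p.
  have := h_max h1 adm1 p (ltnW lt_pe); rewrite full1 // at_p.
  by have := le_N p (ltnW lt_pe); rewrite at_p; lia.
have [p' ep] : exists p', p = p'.+1 by case: (p) p_gt0 => // p' _; exists p'.
have N_p' := nmon3S p'; rewrite -ep in N_p'.
(* The degree e - p' lies above p and is the mirror image of p' = p - 1. *)
have Hp' : minn (N p') (N p - q) <= H p'.
  have := h_max h1 adm1 (e - p') (leq_subr _ _).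
  rewrite high1 ?high; try lia.
  have := H1E (e - p') (leq_subr _ _); rewrite !curve_hilb0 subKn; last by lia.
  rewrite (gh_sym HH); last by lia.
  by have := @leq_nmon p' (e - p'); lia.
pose r := (p.+1 - q).+1.
(* For q <= p, the curve lies on N(q - 2) independent forms of degree p, and N(q - 2) >= q because q
   >= 3. Otherwise r = 1, and a line contributes p + 1 <= N(p) - q. *)
have HCp : curve_hilb r p + q <= N p.
  have [le_qp|lt_pq] := leqP q p.
    have er : r + (q - 2) = p by rewrite /r; lia.
    have [u eu] : exists u, q = u.+3 by exists (q - 3); lia.
    have := curve_hilb_compl r (q - 2); rewrite er eu !subSS subn0 nmon3S.
    by have := leq_nmon (leq0n u); rewrite nmon30; lia.
  have er : r + p' = p by rewrite /r; lia.
  by have := curve_hilb_compl r p'; rewrite er; lia.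
have [|||h2 [H2 [[adm2 _] high2 _ _ H2E]]] :=
  exists_gor_admissible (r := r) (c := N p - q - curve_hilb r p); try lia.
have HCS := curve_hilbS r p.
have H2S : N p - q + minn p.+2 r <= H2 p.+1.
  have := H2E p.+1 _; have := @leq_nmon p.+1 (e - p.+1).
  have := @leq_curve_hilb r p.+1 (e - p.+1); lia.
have := h_max h2 adm2 p.+1 lt_pe; rewrite high2 ?high; try lia.
(* H grows by at most r - 1 from p - 1 to p, but by at least r from p to p + 1 in view of [h2],
   against concavity. *)
have := @gh_concave e H HH p p'; rewrite -ep; lia.
Qed.

End SocleType.

(* Case analysis on p and on the socle dimension in degree p *)
Local Close Scope ring_scope.

Theorem theorem5p1 (k : fieldType) (char_k : [pchar k]%R =i pred0)
    (e p : nat) (he : 1 < e) (hp : 1 <= p < e)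
    (s : seq nat) (size_s : size s = e.+1)
    (s_e : nth 0 s e = 1) (s_p : 1 <= nth 0 s p)
    (s_0 : forall i, i <= e -> i != p -> i != e -> nth 0 s i = 0)
    (m : nat) (min_s : min_emb_dim k s m) (le_m : m <= 3) :
  ((exists A : graded_algebra k 3, generalized_compressed s A) <->
     (p < e %/ 2 /\
        (nth 0 s p <= 2 \/ num_forms 3 p - p <= nth 0 s p)) \/
     e %/ 2 <= p) /\
  (~ (exists A : graded_algebra k 3, generalized_compressed s A) <->
     p < e %/ 2 /\ 3 <= nth 0 s p < num_forms 3 p - p).
Proof.
have [p_gt0 lt_pe] := andP hp.
have -> : num_forms 3 p = nmon 3 p by rewrite nmonE addnC.
have [[A0 A0_s] _] := min_s.
have lt_q := socle_vector_lt p_gt0 lt_pe size_s s_e s_p s_0 le_m A0_s.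
have half : (e %/ 2 <= p) = (e <= p.*2.+1) by lia.
have gencE : (exists A : graded_algebra k 3, generalized_compressed s A) <->
    exists h, max_admissible k 3 s h.
  split=> [[A [h [h_max _ _]]]|[h h_max]]; first by exists h.
  by have [[A [A_s A_h]] _] := h_max; exists A, h; split.
set P := (X in (X <-> _) /\ _).
suff equiv : P <-> (p < e %/ 2 /\
    (nth 0 s p <= 2 \/ nmon 3 p - p <= nth 0 s p)) \/ e %/ 2 <= p.
  split=> //; split=> [notP|[lt_p q_int] /equiv]; last by lia.
  have : ~ (p < e %/ 2 /\ (nth 0 s p <= 2 \/ nmon 3 p - p <= nth 0 s p) \/
    e %/ 2 <= p) by move/equiv.
  by lia.
rewrite {}/P gencE; split=> [ex_max|cond].
  have [ge_p|lt_p] := leqP (e %/ 2) p; first by right.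
  left; split=> //; have [|q_gt2] := leqP (nth 0 s p) 2; first by left.
  right; rewrite leqNgt; apply/negP => small.
  apply: (no_max_admissible char_k p_gt0 lt_pe size_s s_e s_p s_0) ex_max => //; lia.
have points bound := max_admissible_points char_k p_gt0 lt_pe size_s s_e s_p s_0 lt_q bound.
case: cond => [[lt_p cond]|ge_p].
  (* If s_p >= N(p) - p then H p <= p and [gh_small] applies; otherwise s_p <= 2. *)
  have [le_Np|gt_Np] := leqP (nmon 3 p - p) (nth 0 s p).
    apply: points => [|H HH Hp i i_int].
      have /leq_nmon : p <= e - p by lia.
      lia.
    by have := gh_small HH (p := p) (i := i); lia.
  have le_q2 : nth 0 s p <= 2 by lia.
  apply: (max_admissible_curve char_k p_gt0 lt_pe size_s s_e s_p s_0) => //; last by lia.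
  rewrite leqNgt; apply/negP => lt_pq; have /leq_nmon : p <= 1 by lia.
  by rewrite nmon3S nmon30; lia.
(* From half of e on, either the general functional of degree e leaves room for the s_p socle
   elements, or the number of points is cut down to N(p) - s_p. *)
have [fits|lt_N] := leqP (nmon 3 (e - p) + nth 0 s p) (nmon 3 p).
  exact: (max_admissible_compressed char_k p_gt0 lt_pe size_s s_e s_p s_0).
apply: points => [|H HH Hp i i_int]; first exact: ltnW.
by have := gh_le_of_ge_half HH (p := p) (i := i); lia.
Qed.
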